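(* Let $\{X^x_t\}_{t\ge 0,\,x\in\mathcal S}$ be a (time-homogeneous) Markov process on a Polish space $\mathcal S$, let $V$ be a non-negative measurable function on $\mathcal S$, and let $\lambda:[0,\infty)\to[0,\infty)$, $t\mapsto\lambda_t$, be non-decreasing. For $0\le s\le t$ and $y\in\mathcal S$ put $$q(t,y)=\mathbf E\Big[\exp\Big(-\int_0^t V(X^y_u)\,du\Big)\Big],\qquad \hat q(t,s,y)=\mathbf E\Big[\exp\Big(-\int_s^t V(X^y_u)\,du\Big)\Big].$$ Consider a bond market satisfying the following assumptions. 1. The defaultable bond pays one unit of account at the maturity $T$ unless it defaults. 2. At the default time $\tau$ nothing is recovered. 3. The state variable is the Markov process $X^x$, which is observable in the market. 4. With $\mathcal F^X=\{\mathcal F^X_t\}$ the natural filtration of $X^x$, the default time satisfies $$\mathbf E[1_{\{\tau>t\}}\mid\mathcal F^X_t]=\exp\Big(-\int_0^t V(X^x_u)\,du\Big)\qquad(t\ge0).$$ 5. The market filtration is $\mathcal G_t=\sigma(X^x_s,\{\tau\le s\};\,s\le t)$, and $\mathcal F^X_0=\{\Omega,\emptyset\}=\mathcal G_0$. 6. A state price density of the market is given by $\pi_t=q(\lambda_t,X^x_t)$. Then for $0\le t<T$: (i) the price $P_d(t,T)$ at time $t$ of the defaultable zero coupon bond with maturity $T$ is $$P_d(t,T)=1_{\{\tau>t\}}\,\frac{q(\lambda_T+T-t,\,X^x_t)}{q(\lambda_t,X^x_t)};$$ (ii) the price $P_f(t,T)$ at time $t$ of the default-free zero coupon bond with maturity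 $T$ is $$P_f(t,T)=\frac{\hat q(\lambda_T+T-t,\;T-t,\;X^x_t)}{q(\lambda_t,X^x_t)};$$ (iii) the credit spread (which makes sense only when $\tau>t$) is $$\partial_T\log\frac{\hat q(\lambda_T+T-t,\;T-t,\;X^x_t)}{\hat q(\lambda_T+T-t,\;0,\;X^x_t)}.$$
   Context: All random objects live on a probability space $(\Omega,\mathcal F,\mathsf P)$, and $\mathbf E$ is expectation under $\mathsf P$ (the physical measure). $X^y$ denotes the Markov process started at $y\in\mathcal S$. That $\pi$ is a state price density of the market with filtration $\{\mathcal G_t\}$ means that the price at time $t$ of a payoff $H$ delivered at time $T$ is $\pi_t^{-1}\,\mathbf E[H\,\pi_T\mid\mathcal G_t]$. The defaultable zero coupon bond with maturity $T$ and zero recovery has payoff $H=1_{\{\tau>T\}}$. The default-free zero coupon bond with maturity $T$ has payoff $H=1$. The credit spread is $-\partial_T\log\big(P_d(t,T)/P_f(t,T)\big)$, considered only on $\{\tau>t\}$. Note that $\hat q(t,0,y)=q(t,y)$.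
   Formalization: The state variable X^x is additionally assumed to be Markov with respect to the market filtration G_t (not only its natural filtration); without this, assumption 4 lets τ anticipate X and the formula (ii) can fail. *)

(* Defs.v *)
From HB Require Import structures.
From mathcomp Require Import all_boot all_order all_algebra.
From mathcomp Require Import all_classical all_reals all_analysis.
From mathcomp Require Import measurable_realfun.

Set Implicit Arguments.
Unset Strict Implicit.
Unset Printing Implicit Defensive.
Import Order.TTheory GRing.Theory Num.Theory.
Import numFieldNormedType.Exports.
Local Open Scope classical_set_scope.
Local Open Scope ring_scope.

Definition is_metric (R : realType) (S : Type) (dist : S -> S -> R) : Prop :=
  [/\ forall x y, 0 <= dist x y,
      forall x y, dist x y = 0 <-> x = y,
      forall x y, dist x y = dist y x
    & forall x y z, dist x z <= dist x y + dist y z].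

Definition polish_space (R : realType) (S : topologicalType) : Prop :=
  (exists2 D : set S, countable D & dense D) /\
  exists dist : S -> S -> R,
    [/\ is_metric dist,
        forall (x : S) (A : set S), nbhs x A <->
          exists2 e : R, 0 < e & [set y | dist x y < e] `<=` A
      & forall u : nat -> S,
          (forall e : R, 0 < e -> exists N : nat, forall m n : nat,
             (N <= m)%N -> (N <= n)%N -> dist (u m) (u n) < e) ->
          exists l : S, u @ \oo --> l].

Notation borel S := (g_sigma_algebraType (@open S)).

(* Y = E[H | G] almost surely, for a sub-sigma-algebra G.  Y itself need not be
   G-measurable: it has to agree almost surely with a G-measurable version. *)
Definition cond_exp (R : realType) (d : measure_display)
    (Om : measurableType d) (P : probability Om R) (G : set (set Om))
    (H Y : Om -> R) : Prop :=
  P.-integrable [set: Om] (EFin \o H) /\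
  exists Z : Om -> R,
    [/\ P.-integrable [set: Om] (EFin \o Z),
        forall B : set R, measurable B -> G (Z @^-1` B),
        forall A : set Om, G A ->
          (\int[P]_(w in A) (Z w)%:E = \int[P]_(w in A) (H w)%:E)%E
      & {ae P, forall w, Y w = Z w}].

Definition natural_filtration (R : realType) (d : measure_display)
    (Om : measurableType d) (S : ptopologicalType)
    (Y : R -> Om -> borel S) (t : R) : set (set Om) :=
  <<s [set A | exists s : R, 0 <= s <= t /\
         exists2 B : set (borel S), measurable B & A = Y s @^-1` B] >>.

Definition market_filtration (R : realType) (d : measure_display)
    (Om : measurableType d) (S : ptopologicalType)
    (Y : R -> Om -> borel S) (tau : Om -> \bar R) (t : R) : set (set Om) :=
  <<s [set A | exists s : R, 0 <= s <= t /\
         ((exists2 B : set (borel S), measurable B & A = Y s @^-1` B) \/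
          A = [set w | (tau w <= s%:E)%E])] >>.

(* X y is the process started at y, with times t >= 0. *)
Definition transition (R : realType) (d : measure_display)
    (Om : measurableType d) (P : probability Om R) (S : ptopologicalType)
    (X : S -> R -> Om -> borel S) (t : R) (y : S) (B : set (borel S)) : \bar R :=
  P (X y t @^-1` B).

(* Relative to the natural filtration of X y this is the usual Markov property.
   Relative to a larger filtration F it also says that F carries no information
   on the future of X y beyond its present value. *)
Definition markov_wrt (R : realType) (d : measure_display)
    (Om : measurableType d) (P : probability Om R) (S : ptopologicalType)
    (X : S -> R -> Om -> borel S) (y : S) (F : R -> set (set Om)) : Prop :=
  forall (s t : R) (B : set (borel S)), 0 <= s -> 0 <= t -> measurable B ->
    cond_exp P (F s) (\1_(X y (s + t) @^-1` B))
      (fun w => fine (transition P X t (X y s w) B)).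

(* The joint measurability requirements are what makes the integrals of
   V (X y u w) in u random variables, and functions of y measurable. *)
Definition markov_process (R : realType) (d : measure_display)
    (Om : measurableType d) (P : probability Om R) (S : ptopologicalType)
    (X : S -> R -> Om -> borel S) : Prop :=
  [/\ forall y : S, measurable_fun ((`[0, +oo[%classic : set R) `*` [set: Om])
        (fun p : R * Om => X y p.1 p.2),
      forall y : S, {ae P, forall w, X y 0 w = y},
      forall B : set (borel S), measurable B ->
        measurable_fun ((`[0, +oo[%classic : set R) `*` [set: borel S])
          (fun p : R * borel S => transition P X p.1 p.2 B)
    & forall y : S, markov_wrt P X y (natural_filtration (X y))].

(* exp(- \int_s^t V(Y_u) du); the integral may be +oo, with exp(-oo) = 0. *)
Definition discount (R : realType) (d : measure_display)
    (Om : measurableType d) (S : ptopologicalType) (V : borel S -> R)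
    (Y : R -> Om -> borel S) (s t : R) (w : Om) : R :=
  fine (expeR (- \int[@lebesgue_measure R]_(u in `[s, t]) (V (Y u w))%:E)%E).

Definition qhat (R : realType) (d : measure_display)
    (Om : measurableType d) (P : probability Om R) (S : ptopologicalType)
    (X : S -> R -> Om -> borel S) (V : borel S -> R) (t s : R) (y : S) : R :=
  fine ('E_P[discount V (X y) s t])%E.

Definition q (R : realType) (d : measure_display)
    (Om : measurableType d) (P : probability Om R) (S : ptopologicalType)
    (X : S -> R -> Om -> borel S) (V : borel S -> R) (t : R) (y : S) : R :=
  fine ('E_P[discount V (X y) 0 t])%E.

(* p is a version of the price at time t of the payoff H delivered at time T, in
   the market with filtration G and state price density pi.  Where pi t = 0 the
   inverse is 0, hence so is the price. *)
Definition is_price (R : realType) (d : measure_display)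
    (Om : measurableType d) (P : probability Om R) (G : R -> set (set Om))
    (pi : R -> Om -> R) (t T : R) (H p : Om -> R) : Prop :=
  exists2 Z : Om -> R, cond_exp P (G t) (fun w => H w * pi T w) Z
    & {ae P, forall w, p w = (pi t w)^-1 * Z w}.

Definition default_free_payoff (R : realType) (Om : Type) : Om -> R :=
  fun=> 1.

Definition defaultable_payoff (R : realType) (Om : Type)
    (tau : Om -> \bar R) (T : R) : Om -> R :=
  \1_[set w | (T%:E < tau w)%E].

(* The prices of the bonds of each maturity are only defined almost surely, and
   there are uncountably many maturities: the derivative in the maturity is that
   of some version of the price curves.  Any two versions agree almost surely along
   a given sequence of maturities decreasing to T, so c is almost surely unique on
   {tau > t}. *)
Definition is_credit_spread (R : realType) (d : measure_display)
    (Om : measurableType d) (P : probability Om R) (G : R -> set (set Om))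
    (pi : R -> Om -> R) (tau : Om -> \bar R) (t T : R) (c : Om -> R) : Prop :=
  exists Pd Pf : R -> Om -> R,
    [/\ forall U : R, t < U ->
          is_price P G pi t U (defaultable_payoff tau U) (Pd U),
        forall U : R, t < U ->
          is_price P G pi t U (@default_free_payoff R Om) (Pf U)
      & {ae P, forall w, (t%:E < tau w)%E ->
          derivable (fun U : R => ln (Pd U w / Pf U w)) T 1 /\
          c w = - derive1 (fun U : R => ln (Pd U w / Pf U w)) T}].

(* Main.v *)
(** The key fact is the Feynman-Kac form of the Markov property:
    [E[Z exp(- int_s^(s+L) V(X_u) du)] = E[Z q(L, X_s)]] for every nonnegative
    [Z] of the past of [X] at time [s].  No path regularity is available, so it is
    obtained from one-dimensional transitions.  For bounded [0 <= f] the powers of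
    [int_s^(s+L) f(X_u) du] are iterated integrals over a simplex, whose weighted
    expectations are computed by induction with Tonelli and the Markov property;
    summing the exponential series gives the formula for [exp(int f)].  Taking
    [f = k - min(V, k)] makes all terms nonnegative, and [k] tends to infinity.

    For the defaultable bond, an event of the market at time [t] agrees on
    [tau > t] with an event of the past of [X], so the law of [tau] turns the
    indicators of [tau > T] and [tau > t] into discount factors.  The default-free
    price is the market Markov property applied to [q(lambda_T, X_T)].  For the
    spread, price curves with the prescribed values agree almost surely along a
    sequence of maturities decreasing to [T], which determines the derivative. *)

Require Import Defs.
From HB Require Import structures.
From mathcomp Require Import all_boot all_order all_algebra.
From mathcomp Require Import all_classical all_reals all_analysis.
From mathcomp Require Import measurable_realfun.
From mathcomp Require Import ring.

Set Implicit Arguments.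
Unset Strict Implicit.
Unset Printing Implicit Defensive.
Import Order.TTheory GRing.Theory Num.Theory.
Import numFieldNormedType.Exports.
Local Open Scope classical_set_scope.
Local Open Scope ring_scope.

(** * Monotone approximation and changes of weight *)

Lemma ge0_nondecreasing_cvgeMr (R : realType) (u : (\bar R)^nat) (c : \bar R) :
  nondecreasing_seq u -> (forall n, 0 <= u n)%E ->
  (u n * c)%E @[n --> \oo] --> (limn u * c)%E.
Proof.
move=> nu u0; have cu := ereal_nondecreasing_is_cvgn nu.
have [->|c0] := eqVneq c 0%E.
  by under eq_fun do rewrite mule0; rewrite mule0; exact: cvg_cst.
(* Only 0 times infinity could break the product rule for limits. A zero limit of nondecreasing
   nonnegative terms forces every term to be 0, so the product is then constant. *)
have [lu0|lu0] := eqVneq (limn u) 0%E.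
  have {}u0 n : u n = 0%E.
    by apply/eqP; rewrite eq_le u0 andbT -lu0 (cvg_lim _ (ereal_nondecreasing_cvgn nu))//;
    apply: ereal_sup_ubound; exists n.
  rewrite lu0 mul0e; apply: cvg_near_cst; apply: nearW => n.
  by rewrite u0 mul0e.
apply: cvgeM => //; last exact: cvg_cst.
by rewrite mule_defE (negbTE lu0) (negbTE c0).
Qed.

Section nonnegative_induction.
Context d (T : measurableType d) (R : realType).
Local Open Scope ereal_scope.
Import HBNNSimple.

Lemma ge0_measurable_fun_ind (Q : (T -> \bar R) -> Prop) :
  (forall A, measurable A -> Q (fun x => (\1_A x)%:E)) ->
  (forall (k : R) f, (0 <= k)%R -> measurable_fun setT f ->
     (forall x, 0 <= f x) -> Q f -> Q (fun x => k%:E * f x)) ->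
  (forall f g, measurable_fun setT f -> (forall x, 0 <= f x) ->
     measurable_fun setT g -> (forall x, 0 <= g x) ->
     Q f -> Q g -> Q (fun x => f x + g x)) ->
  (forall f : (T -> \bar R)^nat, (forall n, measurable_fun setT (f n)) ->
     (forall n x, 0 <= f n x) -> (forall x, nondecreasing_seq (f ^~ x)) ->
     (forall n, Q (f n)) -> Q (fun x => limn (f ^~ x))) ->
  forall f, measurable_fun setT f -> (forall x, 0 <= f x) -> Q f.
Proof.
move=> Q1 QZ QD Qlim f mf f0; pose g := nnsfun_approx measurableT mf.
have -> : f = (fun x => limn (fun n => (g n x)%:E)).
  by apply/funext => x; apply/esym/cvg_lim => //; exact: cvg_nnsfun_approx.
apply: (Qlim (fun n x => (g n x)%:E)) => [n|n x|x m n mn|n].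
- exact/measurable_EFinP.
- by rewrite lee_fin.
- by rewrite lee_fin; exact/lefP/nd_nnsfun_approx.
move: (g n) => {}g.
have -> : (fun x => (g x)%:E) = (fun x => \sum_(r <- finmap.enum_fset (fset_set (range g)))
    r%:E * (\1_(g @^-1` [set r]) x)%:E).
  by apply/funext => x; rewrite fimfunE fsbig_finite// -sumEFin.
have : all (>= 0)%R (finmap.enum_fset (fset_set (range g))).
  by apply/allP => r; rewrite in_fset_set// inE => -[x _ <-].
have mg r : measurable (g @^-1` [set r]) by [].
have m1 r : measurable_fun setT (fun x : T => (\1_(g @^-1` [set r]) x)%:E : \bar R).
  exact/measurable_EFinP/measurable_indic.
elim: (finmap.enum_fset _) => [_|r s IH /= /andP[r0 s0]].
  under eq_fun do rewrite big_nil.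
  (* The zero function enters the class as a zero multiple of an indicator. *)
  have -> : (fun=> 0) = (fun x : T => 0%:E * (\1_setT x)%:E :> \bar R).
    by apply/funext => x; rewrite mul0e.
  apply: QZ => //; first exact/measurable_EFinP/measurable_indic.
  exact: Q1.
under eq_fun do rewrite big_cons.
have H0 t : (0 <= t)%R -> forall x, 0 <= t%:E * (\1_(g @^-1` [set t]) x)%:E.
  by move=> t0 x; rewrite mule_ge0.
apply: QD.
- exact: measurable_funeM.
- exact: H0.
- by apply: emeasurable_sum => t; exact: measurable_funeM.
- move=> x; rewrite big_seq; apply: sume_ge0 => t ts; apply: H0.
  by move/allP : s0; apply.
- by apply: QZ => //; exact: Q1.
- exact: IH.
Qed.

End nonnegative_induction.

Section change_of_weight.
Context d (T : measurableType d) (R : realType) (mu : {measure set T -> \bar R}).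
Local Open Scope ereal_scope.

(** Conditional expectations are tested on events, while the arguments below need nonnegative
    weights. Only the weight is approximated, so [f] and [g] may be measurable for the large
    sigma-algebra alone. *)
Lemma sub_sigma_algebra_integral_eq (G : set (set T)) (f g : T -> \bar R) :
  <<s G >> `<=` measurable ->
  measurable_fun setT f -> (forall x, 0 <= f x) ->
  measurable_fun setT g -> (forall x, 0 <= g x) ->
  (forall A, <<s G >> A -> \int[mu]_(x in A) f x = \int[mu]_(x in A) g x) ->
  forall h : g_sigma_algebraType G -> \bar R,
    measurable_fun setT h -> (forall x, 0 <= h x) ->
  \int[mu]_x (h x * f x) = \int[mu]_x (h x * g x).
Proof.
move=> Gm mf f0 mg g0 fg.
have mT (h : g_sigma_algebraType G -> \bar R) :
    measurable_fun setT h -> measurable_fun [set: T] (h : T -> \bar R).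
  by move=> mh _ B mB; apply: Gm; have := mh measurableT B mB.
apply: ge0_measurable_fun_ind.
- move=> A mA; have := fg A mA.
  rewrite [in LHS]integral_mkcond [in RHS]integral_mkcond => fgA.
  rewrite [LHS](_ : _ = \int[mu]_x (f \_ A) x); last first.
    apply: eq_integral => x _; rewrite patchE indicE.
    by case: (x \in A); rewrite ?mul1e ?mul0e.
  rewrite fgA; apply: eq_integral => x _; rewrite patchE indicE.
  by case: (x \in A); rewrite ?mul1e ?mul0e.
- move=> k h k0 /mT mh h0 IH.
  under eq_integral do rewrite -muleA.
  under [in RHS]eq_integral do rewrite -muleA.
  by rewrite !ge0_integralZl// ?IH//; [exact: emeasurable_funM|
    move=> x _; exact: mule_ge0|exact: emeasurable_funM|
    move=> x _; exact: mule_ge0].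
- move=> h1 h2 /mT mh1 h10 /mT mh2 h20 IH1 IH2.
  under eq_integral do rewrite ge0_muleDl//.
  under [in RHS]eq_integral do rewrite ge0_muleDl//.
  by rewrite !ge0_integralD// ?IH1 ?IH2//; try (by move=> x _; exact: mule_ge0);
    exact: emeasurable_funM.
- move=> h mh h0 hnd IH.
  have lim_mul (k : T -> \bar R) : (forall x, 0 <= k x) -> measurable_fun setT k ->
      \int[mu]_x (limn (h ^~ x) * k x) = limn (fun n => \int[mu]_x (h n x * k x)).
    move=> k0 mk; rewrite -monotone_convergence//.
    - apply: eq_integral => x _; apply/esym/cvg_lim => //.
      exact: ge0_nondecreasing_cvgeMr.
    - by move=> n; apply: emeasurable_funM => //; exact: mT.
    - by move=> n x _; exact: mule_ge0.
    - by move=> x _ m n mn; apply: lee_wpmul2r => //; exact: hnd.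
  rewrite !lim_mul//; congr (limn _); apply/funext => n; exact: IH.
Qed.

End change_of_weight.

(** * Joint measurability of transition integrals *)

Section parametrized_transition.
Context (R : realType) d (Om : measurableType d) (P : probability Om R).
Context dE (E : measurableType dE) (X : E -> R -> Om -> E).
Hypothesis mX : forall y, measurable_fun setT (fun p : R * Om => X y p.1 p.2).
Hypothesis mtransition : forall B, measurable B ->
  measurable_fun setT (fun p : R * E => P (X p.2 p.1 @^-1` B)).
Local Open Scope ereal_scope.

Let mXt y t : measurable_fun setT (X y t).
Proof. exact: (measurableT_comp (mX y) (pair1_measurable t)). Qed.

(** The parameter is (later time, earlier time, starting point): the iterated integrals below need
    measurability in all three at once. *)
Let law (p : R * R * E) : {measure set E -> \bar R}.
Proof.
refine (pushforward P (X p.2 (p.1.1 - p.1.2)%R) : {measure set E -> \bar R}).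
exact: mXt.
Defined.

Let measurable_law B : measurable B -> measurable_fun setT (law ^~ B).
Proof.
move=> mB.
apply: (measurableT_comp (mtransition mB)
  (g := fun p : R * R * E => ((p.1.1 - p.1.2)%R, p.2))).
apply/measurable_fun_pairP; split => /=; last exact: measurable_snd.
by apply: measurable_funB; apply: measurableT_comp.
Qed.

HB.instance Definition _ := isKernel.Build _ _ _ _ _ law measurable_law.

Let law_uub : measure_fam_uub law.
Proof.
exists 2%R => p; rewrite /law /= /pushforward preimage_setT probability_setT.
by rewrite lte_fin ltr1n.
Qed.

HB.instance Definition _ := Kernel_isFinite.Build _ _ _ _ _ law law_uub.

(** Nothing makes [X y t w] measurable in its starting point [y]. The integral depends on [X]
    through its law only, however, and moved to the state space it is the integral against a finite
    kernel. *)
Lemma measurable_transition_integral (h : R * R * E * E -> \bar R) :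
  measurable_fun setT h -> (forall p, 0 <= h p) ->
  measurable_fun setT
    (fun p : R * R * E => \int[P]_w h (p, X p.2 (p.1.1 - p.1.2)%R w)).
Proof.
move=> mh h0; have := measurable_fun_integral_finite_kernel h law h0 mh.
congr measurable_fun; apply/funext => p; rewrite /law /=.
rewrite ge0_integral_pushforward//=; last first.
  exact: (measurableT_comp mh (pair1_measurable p)).
Qed.

End parametrized_transition.

(** * Iterated integrals along a Markov process *)

Section weighted_fubini.
Context (R : realType) d1 d2 (T1 : measurableType d1) (T2 : measurableType d2).
Variables (m1 : {sigma_finite_measure set T1 -> \bar R}).
Variables (m2 : {sigma_finite_measure set T2 -> \bar R}).
Local Open Scope ereal_scope.

(** Tonelli with each weight kept outside the inner integral, so that after the exchange the inner
    integral is again a weighted one. *)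
Lemma ge0_weighted_fubini (a : T1 -> \bar R) (c : T2 -> \bar R)
    (H : T2 -> T1 -> \bar R) :
  measurable_fun setT a -> (forall x, 0 <= a x) ->
  measurable_fun setT c -> (forall y, 0 <= c y) ->
  measurable_fun setT (fun p => H p.1 p.2) -> (forall y x, 0 <= H y x) ->
  \int[m1]_x (a x * \int[m2]_y (c y * H y x)) =
  \int[m2]_y (c y * \int[m1]_x (a x * H y x)).
Proof.
move=> ma a0 mc c0 mH H0.
transitivity (\int[m1]_x \int[m2]_y (a x * (c y * H y x))).
  apply: eq_integral => x _; rewrite ge0_integralZl//.
  - by apply: emeasurable_funM => //; exact: (measurable_fun_pair1 x mH).
  - by move=> y _; exact: mule_ge0.
transitivity (\int[m2]_y \int[m1]_x (c y * (a x * H y x))); last first.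
  apply: eq_integral => y _; rewrite ge0_integralZl//.
  - by apply: emeasurable_funM => //; exact: (measurable_fun_pair2 y mH).
  - by move=> x _; exact: mule_ge0.
rewrite (fubini_tonelli (m1 := m1) (m2 := m2) (fun p => a p.1 * (c p.2 * H p.2 p.1))).
- by apply: eq_integral => y _; apply: eq_integral => x _ /=; rewrite muleCA.
- apply: emeasurable_funM; first exact: measurableT_comp.
  apply: emeasurable_funM; first exact: measurableT_comp.
  exact: (measurableT_comp mH (@measurable_swap _ _ T1 T2)).
- by move=> p; rewrite !mule_ge0.
Qed.

End weighted_fubini.

(* [G s] generates the sigma-algebra of the filtration at time [s]. *)
Definition generates_markov_filtration (R : realType) d (Om : measurableType d)
    (P : probability Om R) dE (E : measurableType dE) (X : E -> R -> Om -> E)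
    (y : E) (G : R -> set (set Om)) : Prop :=
  [/\ forall s t, s <= t -> G s `<=` G t,
      forall s, <<s G s >> `<=` measurable,
      forall s B, 0 <= s -> measurable B -> <<s G s >> (X y s @^-1` B)
    & forall s u A B, 0 <= s -> 0 <= u -> <<s G s >> A -> measurable B ->
        P (A `&` X y (s + u) @^-1` B) =
        (\int[P]_(w in A) P (X (X y s w) u @^-1` B))%E].

Section markov_moments.
Context (R : realType) d (Om : measurableType d) (P : probability Om R).
Context dE (E : measurableType dE) (X : E -> R -> Om -> E).
Hypothesis mX : forall y, measurable_fun setT (fun p : R * Om => X y p.1 p.2).
Hypothesis mtransition : forall B, measurable B ->
  measurable_fun setT (fun p : R * E => P (X p.2 p.1 @^-1` B)).
Variables (f : E -> \bar R) (L : R).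
Hypothesis mf : measurable_fun setT f.
Hypothesis f0 : forall y, (0 <= f y)%E.
Local Open Scope ereal_scope.
Local Notation mu := (@lebesgue_measure R).

Let mXt y t : measurable_fun setT (X y t).
Proof. exact: (measurable_fun_pair2 t (mX y)). Qed.

(* Integral of [phi] over the ordered simplex [u <= v1 <= ... <= vn <= L]. *)
Fixpoint simplex_integral (phi : R -> \bar R) n (u : R) : \bar R :=
  if n is m.+1 then
    \int[mu]_v ((\1_`[u, L] v)%:E * (phi v * simplex_integral phi m v))
  else 1.

(** This is the [n]-th moment, divided by the factorial of [n], of the integral of [f] over times
    [u] to [L] along a path that is at [y] at time [u]. A new path starts at each level, so only
    one-time transitions enter, never a joint law. *)
Fixpoint moment n (u : R) (y : E) : \bar R :=
  if n is m.+1 then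
    \int[mu]_v ((\1_`[u, L] v)%:E *
      \int[P]_w (f (X y (v - u)%R w) * moment m v (X y (v - u)%R w)))
  else 1.

(** Moving bounds are encoded by an indicator that is jointly measurable in bound and variable, so
    that Tonelli applies on the whole line. *)
Let measurable_window : measurable_fun setT
  (fun p : R * R => (\1_`[p.1, L] p.2)%:E : \bar R).
Proof.
have -> : (fun p : R * R => (\1_`[p.1, L] p.2)%:E : \bar R) =
    (fun p => (\1_[set q : R * R | (q.1 <= q.2 <= L)%R] p)%:E).
  by apply/funext => p; rewrite !indicE; congr (_%:R%:E); apply/idP/idP;
    rewrite !inE /= in_itv.
apply/measurable_EFinP/measurable_indic.
have mb : measurable_fun setT (fun q : R * R => (q.1 <= q.2)%R && (q.2 <= L)%R).
  by apply: measurable_and; apply: measurable_fun_ler.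
by rewrite -[X in measurable X]setTI; exact: (mb measurableT [set true]).
Qed.

Lemma simplex_integral_ge0 phi n u : (forall v, 0 <= phi v) ->
  0 <= simplex_integral phi n u.
Proof.
move=> phi0; elim: n u => [//|n IH] u /=.
by apply: integral_ge0 => v _; rewrite !mule_ge0.
Qed.

Lemma moment_ge0 n u y : 0 <= moment n u y.
Proof.
elim: n u y => [//|n IH] u y /=; apply: integral_ge0 => v _.
by rewrite mule_ge0//; apply: integral_ge0 => w _; rewrite mule_ge0.
Qed.

Lemma measurable_simplex_integral dT (T : measurableType dT)
    (phi : T -> R -> \bar R) n :
  measurable_fun setT (fun p : R * T => phi p.2 p.1) ->
  (forall x v, 0 <= phi x v) ->
  measurable_fun setT (fun p : R * T => simplex_integral (phi p.2) n p.1).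
Proof.
move=> mphi phi0; elim: n => [|n IH]; first exact: measurable_cst.
pose g (q : R * T * R) :=
  (\1_`[q.1.1, L] q.2)%:E * (phi q.1.2 q.2 * simplex_integral (phi q.1.2) n q.2).
apply: (measurable_fun_fubini_tonelli_F (m2 := mu) g).
  have m1 : measurable_fun setT (fun q : R * T * R => (q.2, q.1.2)).
    by apply: measurable_fun_pair => //; exact: measurableT_comp.
  have m2 : measurable_fun setT (fun q : R * T * R => (q.1.1, q.2)).
    by apply: measurable_fun_pair => //; exact: measurableT_comp.
  apply: emeasurable_funM; first exact: (measurableT_comp measurable_window m2).
  apply: emeasurable_funM; first exact: (measurableT_comp mphi m1).
  exact: (measurableT_comp IH m1).
by move=> q; rewrite /g !mule_ge0//; exact: simplex_integral_ge0.
Qed.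

Lemma measurable_moment_step n :
  measurable_fun setT (fun p : R * E => moment n p.1 p.2) ->
  measurable_fun setT (fun q : R * R * E =>
    \int[P]_w (f (X q.2 (q.1.1 - q.1.2)%R w) *
               moment n q.1.1 (X q.2 (q.1.1 - q.1.2)%R w))).
Proof.
move=> mn.
apply: (measurable_transition_integral mX mtransition
  (h := fun p : R * R * E * E => f p.2 * moment n p.1.1.1 p.2)).
  apply: emeasurable_funM; first exact: measurableT_comp.
  apply: (measurableT_comp mn (g := fun p : R * R * E * E => (p.1.1.1, p.2))).
  by apply: measurable_fun_pair => //; do 2 apply: measurableT_comp => //.
by move=> p; rewrite mule_ge0//; exact: moment_ge0.
Qed.

Lemma measurable_moment n : measurable_fun setT (fun p : R * E => moment n p.1 p.2).
Proof.
elim: n => [|n IH]; first exact: measurable_cst.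
pose g (q : R * E * R) := (\1_`[q.1.1, L] q.2)%:E *
  \int[P]_w (f (X q.1.2 (q.2 - q.1.1)%R w) *
             moment n q.2 (X q.1.2 (q.2 - q.1.1)%R w)).
apply: (measurable_fun_fubini_tonelli_F (m2 := mu) g).
  have m2 : measurable_fun setT (fun q : R * E * R => (q.1.1, q.2)).
    by apply: measurable_fun_pair => //; exact: measurableT_comp.
  have m1 : measurable_fun setT (fun q : R * E * R => (q.2, q.1.1, q.1.2)).
    apply: measurable_fun_pair => /=; last exact: measurableT_comp.
    by apply: measurable_fun_pair => //; exact: measurableT_comp.
  apply: emeasurable_funM; first exact: (measurableT_comp measurable_window m2).
  exact: (measurableT_comp (measurable_moment_step IH) m1).
move=> q; rewrite /g mule_ge0//; apply: integral_ge0 => w _.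
by rewrite mule_ge0//; exact: moment_ge0.
Qed.

Variables (y : E) (G : R -> set (set Om)).
Hypothesis GX : generates_markov_filtration P X y G.

Let Gmono s t : (s <= t)%R -> G s `<=` G t. Proof. by case: GX => + _ _ _; exact. Qed.
Let Gmeas s : <<s G s >> `<=` measurable. Proof. by case: GX => _ + _ _; exact. Qed.
Let XG s (B : set E) : (0 <= s)%R -> measurable B -> <<s G s >> (X y s @^-1` B).
Proof. by case: GX => _ _ + _; exact. Qed.
Let markov s u A B : (0 <= s)%R -> (0 <= u)%R -> <<s G s >> A -> measurable B ->
  P (A `&` X y (s + u)%R @^-1` B) = \int[P]_(w in A) P (X (X y s w) u @^-1` B).
Proof. by case: GX => _ _ _; exact. Qed.

Let G_measurable_fun s t (Z : g_sigma_algebraType (G s) -> \bar R) : (s <= t)%R ->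
  measurable_fun setT Z -> measurable_fun setT (Z : g_sigma_algebraType (G t) -> \bar R).
Proof.
move=> st mZ _ B mB; have := mZ measurableT B mB; rewrite !setTI.
by apply: sub_smallest2r; [exact: smallest_sigma_algebra|exact: Gmono].
Qed.

Let G_measurable_funT s (Z : g_sigma_algebraType (G s) -> \bar R) :
  measurable_fun setT Z -> measurable_fun setT (Z : Om -> \bar R).
Proof.
by move=> mZ _ B mB; have := mZ measurableT B mB; rewrite !setTI => /Gmeas.
Qed.

Lemma measurable_one_step u g : measurable_fun setT g -> (forall z, 0 <= g z) ->
  measurable_fun setT (fun z => \int[P]_w g (X z u w)).
Proof.
move=> mg g0.
have := measurable_transition_integral mX mtransition (h := g \o snd).
move=> /(_ (measurableT_comp mg measurable_snd) (fun p => g0 p.2)) h.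
(* The elapsed time [u] is the difference of the times [u] and 0. *)
have := measurableT_comp h (pair1_measurable ((u, 0%R) : R * R)).
by rewrite /comp /= subr0.
Qed.

(** The Markov hypothesis concerns an event of the past and a set of states. The event is extended
    to a weight first, then the set to a function [g] by linearity and monotone limits. *)
Lemma markov_integral s u (g : E -> \bar R) (Z : g_sigma_algebraType (G s) -> \bar R) :
  (0 <= s)%R -> (0 <= u)%R -> measurable_fun setT g -> (forall z, 0 <= g z) ->
  measurable_fun setT Z -> (forall w, 0 <= Z w) ->
  \int[P]_w (Z w * g (X y (s + u)%R w)) =
  \int[P]_w (Z w * \int[P]_w' g (X (X y s w) u w')).
Proof.
move=> s0 u0 mg g0 mZ Z0.
apply: (sub_sigma_algebra_integral_eq (G := G s)) => //.
- exact: (measurableT_comp mg).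
- exact: (measurableT_comp (measurable_one_step u mg g0) (mXt y s)).
- by move=> w; apply: integral_ge0.
move=> A GA; have mA := Gmeas GA.
move: g mg g0; apply: ge0_measurable_fun_ind.
- move=> B mB.
  have mXB z t : measurable (X z t @^-1` B) by rewrite -[X in measurable X]setTI; exact: mXt.
  transitivity (P (A `&` X y (s + u)%R @^-1` B)).
    rewrite setIC -integral_indic//; exact: eq_integral.
  rewrite markov//; apply: eq_integral => w _.
  rewrite -[X in P X]setIT -integral_indic//; exact: eq_integral.
- move=> k g k0 mg g0 IH.
  under [in RHS]eq_integral.
    move=> w _; rewrite ge0_integralZl//; last exact: (measurableT_comp mg).
    over.
  rewrite !ge0_integralZl//= ?IH//.
  + by apply: measurable_funTS;
      exact: (measurableT_comp (measurable_one_step u mg g0) (mXt y s)).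
  + by move=> w _; apply: integral_ge0.
  + by apply: measurable_funTS; exact: (measurableT_comp mg).
- move=> g h mg g0 mh h0 IHg IHh.
  under [in RHS]eq_integral.
    move=> w _; rewrite ge0_integralD//;
      [over|exact: (measurableT_comp mg)|exact: (measurableT_comp mh)].
  rewrite [LHS]ge0_integralD//; last 2 first.
    by apply: measurable_funTS; exact: (measurableT_comp mg).
    by apply: measurable_funTS; exact: (measurableT_comp mh).
  rewrite IHg IHh [RHS]ge0_integralD//.
  + by move=> w _; apply: integral_ge0.
  + by apply: measurable_funTS;
      exact: (measurableT_comp (measurable_one_step u mg g0) (mXt y s)).
  + by move=> w _; apply: integral_ge0.
  + by apply: measurable_funTS;
      exact: (measurableT_comp (measurable_one_step u mh h0) (mXt y s)).
- move=> g mg g0 ndg IH.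
  under [in RHS]eq_integral.
    move=> w _; rewrite (monotone_convergence P measurableT
      (g' := fun n w' => g n (X (X y s w) u w'))).
    over.
    + by move=> n; exact: (measurableT_comp (mg n)).
    + by [].
    + by move=> w' _ m n; exact: ndg.
  rewrite (monotone_convergence P mA
    (g' := fun n w => g n (X y (s + u)%R w))); last 3 first.
    + by move=> n; apply: measurable_funTS; exact: (measurableT_comp (mg n)).
    + by [].
    + by move=> w _ m n; exact: ndg.
  rewrite (monotone_convergence P mA
    (g' := fun n w => \int[P]_w' g n (X (X y s w) u w'))); last 3 first.
    + move=> n; apply: measurable_funTS.
      exact: (measurableT_comp (measurable_one_step u (mg n) (g0 n)) (mXt y s)).
    + by move=> n w _; apply: integral_ge0.
    + move=> w _ m n mn; apply: ge0_le_integral => //.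
      * exact: (measurableT_comp (mg m)).
      * exact: (measurableT_comp (mg n)).
      * by move=> w' _; exact: ndg.
  by congr (limn _); apply/funext => n; exact: IH.
Qed.

Let mXs s : measurable_fun setT (fun p : R * Om => X y (s + p.1)%R p.2).
Proof.
apply: (measurableT_comp (mX y) (g := fun p : R * Om => ((s + p.1)%R, p.2))).
by apply: measurable_fun_pair => //; exact: measurable_funD.
Qed.

Let measurable_simplex_path s n :
  measurable_fun setT (fun p : R * Om =>
    simplex_integral (fun v => f (X y (s + v)%R p.2)) n p.1).
Proof.
apply: (measurable_simplex_integral (phi := fun w v => f (X y (s + v)%R w))) => //.
exact: (measurableT_comp mf (mXs s)).
Qed.

(* Integrate out the last path segment first: the factor [f (X_(s + v))] joins
   the weight, and the Markov property at [s + v] then applies by induction. *)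
Lemma weighted_moment n s u (Z : g_sigma_algebraType (G (s + u)) -> \bar R) :
  (0 <= s)%R -> (0 <= u)%R -> measurable_fun setT Z -> (forall w, 0 <= Z w) ->
  \int[P]_w (Z w * simplex_integral (fun v => f (X y (s + v)%R w)) n u) =
  \int[P]_w (Z w * moment n u (X y (s + u)%R w)).
Proof.
move=> s0; elim: n u Z => [//|n IH] u Z u0 mZ Z0 /=.
have mwin : measurable_fun setT (fun v : R => (\1_`[u, L] v)%:E : \bar R).
  exact: (measurable_fun_pair2 u measurable_window).
have win0 (v : R) : 0 <= (\1_`[u, L] v)%:E :> \bar R by [].
have mZT := G_measurable_funT mZ.
(* On both sides the time integral is moved outside, so that it suffices to compare expectations at
   each fixed [v] in the window. *)
rewrite (ge0_weighted_fubini P mu (H := fun v w =>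
  f (X y (s + v)%R w) * simplex_integral (fun v => f (X y (s + v)%R w)) n v)
  mZT Z0 mwin win0); last 2 first.
- apply: emeasurable_funM; first exact: (measurableT_comp mf (mXs s)).
  exact: measurable_simplex_path.
- by move=> v w; rewrite mule_ge0// simplex_integral_ge0.
rewrite (ge0_weighted_fubini P mu (H := fun v w =>
  \int[P]_w' (f (X (X y (s + u)%R w) (v - u)%R w') *
     moment n v (X (X y (s + u)%R w) (v - u)%R w'))) mZT Z0 mwin win0); last 2 first.
- apply: (measurableT_comp (measurable_moment_step (measurable_moment n))
    (g := fun p : R * Om => (p.1, u, X y (s + u)%R p.2))).
  apply: measurable_fun_pair; first exact: measurable_fun_pair.
  exact: (measurableT_comp (mXt y (s + u))).
- by move=> v w; apply: integral_ge0 => w' _; rewrite mule_ge0// moment_ge0.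
apply: eq_integral => v _; rewrite indicE.
have [|] := boolP (v \in `[u, L]); last first.
  move=> vuL; rewrite (_ : (v \in _) = false) ?mul0e//; apply/negP.
  by rewrite inE/= => vL; rewrite vL in vuL.
rewrite in_itv/= => /andP[uv vL]; congr (_ * _).
have suv : (s + u <= s + v)%R by rewrite lerD2l.
have mZf : measurable_fun setT
    ((fun w => Z w * f (X y (s + v)%R w)) : g_sigma_algebraType (G (s + v)) -> \bar R).
  apply: emeasurable_funM; first exact: G_measurable_fun mZ.
  apply: (measurableT_comp mf) => _ B mB; rewrite setTI.
  by apply: XG => //; rewrite addr_ge0// (le_trans u0 uv).
under eq_integral do rewrite muleA.
rewrite (IH v _ (le_trans u0 uv) mZf); last by move=> w; exact: mule_ge0.
under eq_integral do rewrite -muleA.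
have mm : measurable_fun setT (fun z => f z * moment n v z).
  by apply: emeasurable_funM => //; exact: (measurable_fun_pair2 v (measurable_moment n)).
(* The induction hypothesis has expressed everything through the state at [s + v]; one more
   transition, of length [v - u], leads back to the state at [s + u]. *)
have := markov_integral (s := (s + u)%R) (u := (v - u)%R) _ _ mm _ mZ Z0.
have -> : (s + u + ((v : R) - u) = s + v)%R by ring.
apply; [exact: addr_ge0|by rewrite subr_ge0|].
by move=> z; rewrite mule_ge0// moment_ge0.
Qed.

End markov_moments.

(** * Simplex integrals and the exponential series *)

Lemma ge0_integral_itv_split (R : realType) (f : R -> \bar R) (a b c : R) :
  measurable_fun setT f -> (forall v, (0 <= f v)%E) -> a <= b -> b <= c ->
  (\int[@lebesgue_measure R]_(v in `[a, c]) f v =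
   \int[@lebesgue_measure R]_(v in `[a, b]) f v +
   \int[@lebesgue_measure R]_(v in `[b, c]) f v)%E.
Proof.
(* The common endpoint is a null set; without it the first interval is disjoint from the second. *)
move=> mf f0 ab bc; rewrite -(integral_itv_bndo_bndc (r := b)); last exact: measurable_funTS.
rewrite -ge0_integral_setU//.
- by rewrite -itv_bndbnd_setU ?bnd_simp.
- exact: measurable_funTS.
- by rewrite disj_set2E; apply/eqP/seteqP; split=> x //=; rewrite !in_itv/=
    => -[/andP[_ xb] /andP[bx _]]; rewrite ltNge bx in xb.
Qed.

Section simplex_exponential.
Context (R : realType) (L : R) (phi : R -> \bar R).
Hypothesis mphi : measurable_fun setT phi.
Hypothesis phi0 : forall v, (0 <= phi v)%E.
Local Open Scope ereal_scope.
Local Notation mu := (@lebesgue_measure R).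

Let measurable_itv : measurable_fun setT
  (fun p : R * R * R => (\1_`[p.1.1, p.1.2] p.2)%:E : \bar R).
Proof.
have -> : (fun p : R * R * R => (\1_`[p.1.1, p.1.2] p.2)%:E : \bar R) =
    (fun p => (\1_[set q : R * R * R | (q.1.1 <= q.2 <= q.1.2)%R] p)%:E).
  by apply/funext => p; rewrite !indicE; congr (_%:R%:E); apply/idP/idP;
    rewrite !inE /= in_itv.
apply/measurable_EFinP/measurable_indic.
have mb : measurable_fun setT
    (fun q : R * R * R => (q.1.1 <= q.2)%R && (q.2 <= q.1.2)%R).
  by apply: measurable_and; apply: measurable_fun_ler => //; exact: measurableT_comp.
by rewrite -[X in measurable X]setTI; exact: (mb measurableT [set true]).
Qed.

Let itv_fun dT (T : measurableType dT) (a b c : T -> R) :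
  measurable_fun setT a -> measurable_fun setT b -> measurable_fun setT c ->
  measurable_fun setT (fun x => (\1_`[a x, b x] (c x))%:E : \bar R).
Proof.
move=> ma mb mc.
apply: (measurableT_comp measurable_itv (g := fun x => (a x, b x, c x))).
by apply: measurable_fun_pair => //; exact: measurable_fun_pair.
Qed.

Let A (a b : R) := \int[mu]_v ((\1_`[a, b] v)%:E * phi v).

Let mA dT (T : measurableType dT) (a b : T -> R) :
  measurable_fun setT a -> measurable_fun setT b ->
  measurable_fun setT (fun x => A (a x) (b x)).
Proof.
move=> ma mb.
apply: (measurable_fun_fubini_tonelli_F (m2 := mu)
  (fun p : T * R => (\1_`[a p.1, b p.1] p.2)%:E * phi p.2)).
  apply: emeasurable_funM; last exact: measurableT_comp.
  by apply: itv_fun => //; exact: measurableT_comp.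
by move=> p; rewrite mule_ge0.
Qed.

Let A0 a b : 0 <= A a b.
Proof. by apply: integral_ge0 => v _; rewrite mule_ge0. Qed.

Let AE a b : A a b = \int[mu]_(v in `[a, b]) phi v.
Proof.
rewrite integral_mkcond; apply: eq_integral => v _; rewrite patchE indicE.
by case: (v \in _); rewrite ?mul1e ?mul0e.
Qed.

Let Achasles a b c : (a <= b)%R -> (b <= c)%R -> A a b + A b c = A a c.
Proof. by move=> ab bc; rewrite !AE -ge0_integral_itv_split. Qed.

(* Adding the iterated integrals over [u <= v <= z] and [u <= z <= v] gives the
   product of the integrals in [v] and [z], so no subtraction is needed. *)
Lemma simplex_integralS n u :
  n.+1%:R%:E * simplex_integral L phi n.+1 u =
  (\int[mu]_(v in `[u, L]) phi v) * simplex_integral L phi n u.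
Proof.
have : forall n, measurable_fun setT (simplex_integral L phi n).
  move=> m; have := measurable_simplex_integral (phi := fun=> phi) L m
    (measurableT_comp mphi (@measurable_fst _ _ R R)) (fun=> phi0).
  by move=> /(measurable_fun_pair1 (0 : R)%R).
have : forall n u, 0 <= simplex_integral L phi n u.
  by move=> m v; exact: simplex_integral_ge0.
have : forall m u, simplex_integral L phi m.+1 u =
    \int[mu]_v ((\1_`[u, L] v)%:E * (phi v * simplex_integral L phi m v)) by [].
have : forall u, simplex_integral L phi 0 u = 1 by [].
rewrite -AE; move: (simplex_integral L phi) => S S1E SE S0 mS.
elim: n u => [u|n IH u].
  by rewrite mul1e SE S1E mule1; apply: eq_integral => v _; rewrite S1E mule1.
pose c v := phi v * S n v.
have mc : measurable_fun setT c by exact: emeasurable_funM.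
have c0 v : 0 <= c v by rewrite mule_ge0.
have mitv (a b : R) : measurable_fun setT (fun v : R => (\1_`[a, b] v)%:E : \bar R).
  exact: itv_fun.
have mwphi (a b : R) : measurable_fun setT (fun z : R => (\1_`[a, b] z)%:E * phi z).
  exact: emeasurable_funM.
have mwS (a b : R) m :
    measurable_fun setT (fun z : R => (\1_`[a, b] z)%:E * (phi z * S m z)).
  by do 2 apply: emeasurable_funM => //.
have mwA (g : R -> \bar R) : measurable_fun setT g ->
    measurable_fun setT (fun v : R => c v * ((\1_`[u, L] v)%:E * g v)).
  by move=> mg; do 2 apply: emeasurable_funM => //.
(* The smallest variable [z] is integrated out first, which leaves the integral of [phi] from [u] to
   the second variable [v]. *)
have S2 : S n.+2 u = \int[mu]_v (c v * ((\1_`[u, L] v)%:E * A u v)).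
  transitivity (\int[mu]_z ((\1_`[u, L] z)%:E * phi z *
                            \int[mu]_v (c v * (\1_`[z, L] v)%:E))).
    rewrite SE; apply: eq_integral => z _; rewrite SE -muleA; congr (_ * (_ * _)).
    by apply: eq_integral => v _; rewrite muleC.
  rewrite (ge0_weighted_fubini mu mu (H := fun v z => (\1_`[z, L] v)%:E))//.
  - apply: eq_integral => v _; congr (_ * _).
    rewrite -ge0_integralZl//; last 2 first.
    + exact: mwphi.
    + by move=> z _; rewrite mule_ge0.
    apply: eq_integral => z _; rewrite muleAC muleA -!EFinM; congr (_%:E * _).
    rewrite !indicE -!natrM !mulnb !mem_setE; congr ((nat_of_bool _)%:R); apply/idP/idP.
    + rewrite !in_itv/= => /andP[/andP[uz zL] /andP[zv vL]].
      by rewrite (le_trans uz zv) vL uz zv.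
    + rewrite !in_itv/= => /andP[/andP[uv vL] /andP[uz zv]].
      by rewrite uz (le_trans zv vL) zv vL.
  - exact: mwphi.
  - by move=> z; rewrite mule_ge0.
  - exact: itv_fun.
(* Here the induction hypothesis at the smallest variable [v] supplies the complementary integral,
   from [v] to [L]. *)
have S1 : n.+1%:R%:E * S n.+2 u = \int[mu]_v (c v * ((\1_`[u, L] v)%:E * A v L)).
  rewrite SE.
  rewrite -(ge0_integralZl mu measurableT (mwS u L n.+1) (k := n.+1%:R%:E)); last 2 first.
  - by move=> v _; rewrite !mule_ge0.
  - by rewrite lee_fin.
  apply: eq_integral => v _; rewrite muleCA (muleCA _ (phi v)) IH.
  by rewrite /c muleCA -muleA; congr (_ * _); rewrite muleA muleC.
(* Of the [n + 2] copies of the simplex integral, [n + 1] are taken in the form [S1] and one in the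
   form [S2]; the two inner integrals then add up to the one from [u] to [L]. *)
rewrite -(natr1 n.+1) EFinD ge0_muleDl// mul1e S1 S2 -ge0_integralD//; last 4 first.
- by move=> v _; rewrite !mule_ge0.
- by apply: mwA; exact: mA.
- by move=> v _; rewrite !mule_ge0.
- by apply: mwA; exact: mA.
rewrite SE -(ge0_integralZl mu measurableT (mwS u L n) (k := A u L)); last 2 first.
- by move=> v _; rewrite !mule_ge0.
- exact: A0.
apply: eq_integral => v _; rewrite -/(c v) indicE.
have [|_] := boolP (v \in _); last by rewrite !mul0e !mule0 adde0.
rewrite inE/= in_itv/= => /andP[uv vL].
by rewrite !mul1e -ge0_muleDr// addeC Achasles// muleC.
Qed.

End simplex_exponential.

Section simplex_series.
Context (R : realType) (L : R) (phi : R -> \bar R).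
Hypothesis mphi : measurable_fun setT phi.
Hypothesis phi0 : forall v, (0 <= phi v)%E.
Local Open Scope ereal_scope.
Local Notation mu := (@lebesgue_measure R).

(** With a finite total integral [r], [simplex_integralS] becomes the recursion of the exponential
    coefficients, each being the previous one times [r] over its index. *)
Lemma simplex_integralE (r : R) u n : \int[mu]_(v in `[u, L]) phi v = r%:E ->
  simplex_integral L phi n u = (exp_coeff r n)%:E.
Proof.
move=> ur; elim: n => [|n IH]; first by rewrite /exp_coeff/= expr0 fact0 divr1.
have := simplex_integralS L mphi phi0 n u; rewrite ur IH => h.
have n0 : (n.+1%:R != 0 :> R)%R by rewrite pnatr_eq0.
rewrite -[LHS]mul1e -[1](_ : (n.+1%:R^-1 * n.+1%:R)%:E = _); last by rewrite mulVf.
rewrite EFinM -muleA [X in _ * X]h -!EFinM /exp_coeff/= factS natrM exprS; congr _%:E.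
have f0 : (n`!%:R != 0 :> R)%R by rewrite pnatr_eq0 -lt0n fact_gt0.
by field; rewrite f0 addrC natr1.
Qed.

Lemma nneseries_simplex_integral (r : R) u : \int[mu]_(v in `[u, L]) phi v = r%:E ->
  \sum_(n <oo) simplex_integral L phi n u = (expR r)%:E.
Proof.
move=> ur; rewrite /expR -EFin_lim; last exact: is_cvg_series_exp_coeff.
congr (limn _); apply/funext => n /=; rewrite /series/= -sumEFin.
by apply: eq_bigr => i _; rewrite (simplex_integralE _ ur).
Qed.

End simplex_series.

(** The limit +oo has to be allowed, since a path integral of an unbounded potential can be
    infinite; the exponentials then tend to 0. *)
Lemma cvg_expRN (R : realType) (r : R^nat) (a : \bar R) :
  (forall n, 0 <= r n) -> (r n)%:E @[n --> \oo] --> a ->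
  expR (- r n) @[n --> \oo] --> fine (expeR (- a)%E).
Proof.
move=> r0; case: a => [a| |] ra.
- apply: continuous_cvg => /=; first exact: continuous_expR.
  by apply: cvgN; have /fine_cvgP[] := ra.
- have {}ra : r n @[n --> \oo] --> +oo by exact/cvgeryP.
  exact: (cvg_comp _ _ ra (@cvgr_expR R)).
- have : (0 <= -oo :> \bar R)%E.
    by rewrite -(cvg_lim _ ra)//; apply: lime_ge;
      [exact: cvgP ra|by apply: nearW => n; rewrite lee_fin].
  by rewrite leNgt ltNye.
Qed.

(** * The Markov property for killed processes *)

Section feynman_kac.
Context (R : realType) d (Om : measurableType d) (P : probability Om R).
Context dE (E : measurableType dE) (X : E -> R -> Om -> E).
Hypothesis mX : forall y, measurable_fun setT (fun p : R * Om => X y p.1 p.2).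
Hypothesis mtransition : forall B, measurable B ->
  measurable_fun setT (fun p : R * E => P (X p.2 p.1 @^-1` B)).
Hypothesis X0 : forall y, {ae P, forall w, X y 0 w = y}.
Variable G : E -> R -> set (set Om).
Hypothesis GX : forall y, generates_markov_filtration P X y (G y).
Variable L : R.
Local Notation mu := (@lebesgue_measure R).

Let mXt y t : measurable_fun setT (X y t).
Proof. exact: (measurable_fun_pair2 t (mX y)). Qed.

Let mXs y s : measurable_fun setT (fun p : R * Om => X y (s + p.1) p.2).
Proof.
apply: (measurableT_comp (mX y) (g := fun p : R * Om => (s + p.1, p.2))).
by apply: measurable_fun_pair => //; exact: measurable_funD.
Qed.

(** The path is shifted and the window stays at [0, L], which is the form that [weighted_moment]
    yields at [u = 0]. The link with the window [s, s + L] is made in [discountE]. *)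
Definition path_integral (g : E -> R) (y : E) (s : R) (w : Om) : \bar R :=
  (\int[mu]_(v in `[0%R, L]) (g (X y (s + v)%R w))%:E)%E.

Definition killing (g : E -> R) (y : E) (s : R) (w : Om) : R :=
  fine (expeR (- path_integral g y s w)%E).

(** For the process of the theorem this becomes [q] with horizon [L], by [qE]. *)
Definition survival (g : E -> R) (y : E) : R :=
  fine (\int[P]_w (killing g y 0 w)%:E)%E.

Let mpath (g : E -> R) y s w : measurable_fun setT g ->
  measurable_fun setT (fun v : R => (g (X y (s + v) w))%:E).
Proof.
move=> mg; apply/measurable_EFinP/(measurableT_comp mg).
exact: (measurable_fun_pair1 w (mXs y s)).
Qed.

Lemma measurable_path_integral (g : E -> R) y s : measurable_fun setT g ->
  (forall z, 0 <= g z) -> measurable_fun setT (path_integral g y s).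
Proof.
move=> mg g0.
have m1 : measurable_fun setT (fun v : R => (\1_`[0%R, L] v)%:E : \bar R).
  exact/measurable_EFinP/measurable_indic.
have mh : measurable_fun setT (fun p : Om * R =>
    ((\1_`[0%R, L] p.2)%:E * (g (X y (s + p.2)%R p.1))%:E)%E).
  apply: emeasurable_funM.
    exact: (measurableT_comp m1 (@measurable_snd _ _ Om R)).
  apply/measurable_EFinP/(measurableT_comp mg).
  exact: (measurableT_comp (mXs y s) (@measurable_swap _ _ Om R)).
have h := measurable_fun_fubini_tonelli_F (m2 := mu) _ mh.
have -> : path_integral g y s = fubini_F mu (fun p : Om * R =>
    ((\1_`[0%R, L] p.2)%:E * (g (X y (s + p.2)%R p.1))%:E)%E).
  apply/funext => w; rewrite /path_integral integral_mkcond.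
  apply: eq_integral => v _; rewrite patchE indicE.
  by case: (v \in _); rewrite ?mul1e ?mul0e.
by apply: h => p; rewrite mule_ge0// lee_fin.
Qed.

Section bounded.
Variables (g : E -> R) (k : R).
Hypothesis mg : measurable_fun setT g.
Hypotheses (g0 : forall z, 0 <= g z) (gk : forall z, g z <= k).

(** The sign of [L] is free: for negative [L] the window is empty and [ell] is 0. *)
Let ell := fine (mu `[0, L]).

Let muE : mu `[0, L] = ell%:E.
Proof.
rewrite /ell fineK// lebesgue_measure_itv/=.
by case: ifP => // _; rewrite oppe0 adde0.
Qed.

Let f z := k - g z.
Let f0 z : 0 <= f z. Proof. by rewrite subr_ge0. Qed.
Let mf : measurable_fun setT f. Proof. exact: measurable_funB. Qed.
Let fE z : (0 <= (f z)%:E)%E. Proof. by rewrite lee_fin. Qed.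
Let mfE : measurable_fun setT (EFin \o f). Proof. exact/measurable_EFinP. Qed.

Let split_integral y s w :
  (path_integral g y s w + path_integral f y s w = (k * ell)%:E)%E.
Proof.
rewrite /path_integral -ge0_integralD//; last 3 first.
- by move=> v _; rewrite lee_fin.
- by apply: measurable_funTS; exact: mpath.
- by apply: measurable_funTS; exact: mpath.
under eq_integral do rewrite -EFinD /f addrC subrK.
by rewrite (integral_cst mu)// [X in (_ * X)%E]muE.
Qed.

Let path_integral_ge0 (h : E -> R) y s w : (forall z, 0 <= h z) ->
  (0 <= path_integral h y s w)%E.
Proof. by move=> h0; apply: integral_ge0 => v _; rewrite lee_fin. Qed.

Let path_integral_fin y s w :
  path_integral g y s w \is a fin_num /\ path_integral f y s w \is a fin_num.
Proof.
have := split_integral y s w; move: (path_integral_ge0 y s w g0) (path_integral_ge0 y s w f0).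
by case: path_integral => //; case: path_integral.
Qed.

Let killingE y s w : killing g y s w = expR (- fine (path_integral g y s w)).
Proof.
have [gfin _] := path_integral_fin y s w.
by rewrite /killing -(fineK gfin).
Qed.

Let killing_compl y s w :
  expR (fine (path_integral f y s w)) = expR (k * ell) * killing g y s w.
Proof.
have [gfin ffin] := path_integral_fin y s w.
rewrite killingE -expRD; congr expR; have := split_integral y s w.
by rewrite -(fineK gfin) -(fineK ffin) -EFinD => -[<-] /=; ring.
Qed.

(** This series stands for the expectation of exp of the integral of [f] along the path from [z]. It
    is measurable in [z] because the moments are; [WE] identifies its value. *)
Let W z : \bar R := (\sum_(n <oo) moment P X (EFin \o f) L n 0%R z)%E.

Let mW : measurable_fun setT W.
Proof.
apply: (ge0_emeasurable_sum (P := xpredT)) => [n z _ _|n _]; first exact: moment_ge0.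
exact: (measurable_fun_pair2 (0 : R)%R (measurable_moment mX mtransition L mfE fE n)).
Qed.

(** The exponential is expanded into simplex integrals, each term is treated by [weighted_moment],
    and the series is summed again. Sums and expectations commute because all terms are
    nonnegative. *)
Let exp_moment y s (Z : Om -> R) : 0 <= s ->
  measurable_fun setT (Z : g_sigma_algebraType (G y s) -> R) -> (forall w, 0 <= Z w) ->
  (\int[P]_w ((Z w)%:E * (expR (fine (path_integral f y s w)))%:E) =
   \int[P]_w ((Z w)%:E * W (X y s w)))%E.
Proof.
move=> s0 mZ Z0; have [Gm1 Gm2 Gm3 Gm4] := GX y.
have mZT : measurable_fun [set: Om] Z.
  by move=> _ B mB; have := mZ measurableT B mB; rewrite !setTI => /Gm2.
have mE : measurable_fun [set: Om] (EFin \o Z) by exact/measurable_EFinP.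
have msimplex n : measurable_fun setT
    (fun w => simplex_integral L (fun v => (f (X y (s + v)%R w))%:E) n 0%R).
  have := measurable_simplex_integral (phi := fun w v => (f (X y (s + v)%R w))%:E) L n.
  move=> /(_ (measurableT_comp mfE (mXs y s)) (fun w v => fE _)) h.
  exact: (measurable_fun_pair2 (0 : R)%R h).
transitivity (\int[P]_w \sum_(n <oo)
    ((Z w)%:E * simplex_integral L (fun v => (f (X y (s + v)%R w))%:E) n 0%R))%E.
  apply: eq_integral => w _.
  rewrite nneseriesZl; last by move=> n _; apply: simplex_integral_ge0.
  rewrite (nneseries_simplex_integral (phi := fun v => (f (X y (s + v)%R w))%:E) _ _
    (r := fine (path_integral f y s w)))//.
  - exact: mpath.
  - by rewrite fineK//; case: (path_integral_fin y s w).
rewrite integral_nneseries//; last 2 first.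
- by move=> n; exact: emeasurable_funM.
- by move=> n w _; rewrite mule_ge0 ?lee_fin//; exact: simplex_integral_ge0.
transitivity (\sum_(n <oo) \int[P]_w
    ((Z w)%:E * moment P X (EFin \o f) L n 0%R (X y s w)))%E.
  apply: eq_eseriesr => n _.
  have := weighted_moment mX mtransition L mfE fE (GX y) n
    (s := s) (u := 0) (Z := EFin \o Z).
  by rewrite addr0; apply=> //; exact/measurable_EFinP.
rewrite -integral_nneseries//; last 2 first.
- move=> n; apply: emeasurable_funM => //.
  apply: (measurableT_comp _ (mXt y s)).
  exact: (measurable_fun_pair2 (0 : R)%R (measurable_moment mX mtransition L mfE fE n)).
- by move=> n w _; rewrite mule_ge0 ?lee_fin//; exact: moment_ge0.
apply: eq_integral => w _; rewrite nneseriesZl// => n _; exact: moment_ge0.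
Qed.

Let killing_int z := (\int[P]_w (killing g z 0 w)%:E)%E.

Let killing_ge0 y s w : 0 <= killing g y s w.
Proof. by rewrite killingE expR_ge0. Qed.

Let mkilling y s : measurable_fun setT (killing g y s).
Proof.
have -> : killing g y s = expR \o (fun w => - fine (path_integral g y s w)).
  by apply/funext => w; exact: killingE.
apply: measurableT_comp => //; apply: measurable_funN.
by apply: measurableT_comp => //; exact: measurable_path_integral.
Qed.

(** This is [exp_moment] at time 0 with weight 1: the path almost surely starts at [z], so the
    expectation of [W] at its initial state is [W z]. *)
Let WE z : W z = ((expR (k * ell))%:E * killing_int z)%E.
Proof.
have h := exp_moment (y := z) (lexx 0) (measurable_cst (1 : R)) (fun=> ler01).
transitivity (\int[P]_w (1%:E * W (X z 0 w)))%E.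
  rewrite -[LHS]mule1 -[X in (_ * X = _)%E](probability_setT P) -integral_cst//.
  apply: ae_eq_integral => //.
    by apply: emeasurable_funM => //; exact: measurableT_comp.
  by apply: filterS (X0 z) => w Xw _; rewrite Xw mul1e.
rewrite -h /killing_int -ge0_integralZl//; last 2 first.
- exact/measurable_EFinP.
- by move=> w _; rewrite lee_fin.
by apply: eq_integral => w _; rewrite mul1e killing_compl EFinM.
Qed.

Let killing_le1 y s w : killing g y s w <= 1.
Proof.
rewrite killingE -[leRHS]expR0 ler_expR oppr_le0 fine_ge0//.
exact: path_integral_ge0.
Qed.

Let survivalE z : killing_int z = (survival g z)%:E.
Proof.
rewrite /survival fineK// ge0_fin_numE; last first.
  by apply: integral_ge0 => w _; rewrite lee_fin.
rewrite (@le_lt_trans _ _ (\int[P]_w 1)%E)//; last first.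
  rewrite integral_cst// mul1e.
  by apply: le_lt_trans (probability_le1 P measurableT) _; rewrite ltry.
apply: ge0_le_integral => //.
- by move=> w _; rewrite lee_fin.
- exact/measurable_EFinP.
- by move=> w _; rewrite lee_fin.
Qed.

Let survival_ge0 z : 0 <= survival g z.
Proof. by apply: fine_ge0; apply: integral_ge0 => w _; rewrite lee_fin. Qed.

(** Measurability in the starting point is inherited from [W], of which the survival function is a
    constant multiple. *)
Lemma bounded_survival_measurable : measurable_fun setT (survival g).
Proof.
have -> : survival g = fine \o (fun z => (expR (- (k * ell)))%:E * W z)%E.
  apply/funext => z /=; rewrite WE survivalE -!EFinM /=.
  by rewrite mulrA -expRD addNr expR0 mul1r.
by apply: measurableT_comp => //; exact: measurable_funeM.
Qed.

Lemma bounded_killing_measurable y s : measurable_fun setT (killing g y s).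
Proof. exact: mkilling. Qed.

Lemma bounded_killingE y s w : killing g y s w = expR (- fine (path_integral g y s w))
  /\ path_integral g y s w \is a fin_num.
Proof. by split; [exact: killingE|case: (path_integral_fin y s w)]. Qed.

(** Both sides of [exp_moment] carry the same positive finite factor exp(k * ell), which cancels. *)
Lemma bounded_markov_killing y s (Z : Om -> R) : 0 <= s ->
  measurable_fun setT (Z : g_sigma_algebraType (G y s) -> R) -> (forall w, 0 <= Z w) ->
  (\int[P]_w (Z w * killing g y s w)%:E =
   \int[P]_w (Z w * survival g (X y s w))%:E)%E.
Proof.
move=> s0 mZ Z0; have := exp_moment s0 mZ Z0; have [_ Gm2 _ _] := GX y.
have mZT : measurable_fun [set: Om] Z.
  by move=> _ B mB; have := mZ measurableT B mB; rewrite !setTI => /Gm2.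
pose c := expR (k * ell).
rewrite (_ : (\int[P]_w _ = c%:E * \int[P]_w (Z w * killing g y s w)%:E)%E); last first.
  rewrite -ge0_integralZl.
  - by apply: eq_integral => w _; rewrite -!EFinM killing_compl mulrCA.
  - by [].
  - by apply/measurable_EFinP; exact: measurable_funM.
  - by move=> w _; rewrite lee_fin mulr_ge0.
  - by rewrite lee_fin expR_ge0.
rewrite (_ : (\int[P]_w ((Z w)%:E * _) =
    c%:E * \int[P]_w (Z w * survival g (X y s w))%:E)%E); last first.
  rewrite -ge0_integralZl.
  - by apply: eq_integral => w _; rewrite WE survivalE -!EFinM mulrCA.
  - by [].
  - apply/measurable_EFinP; apply: measurable_funM => //.
    exact: (measurableT_comp bounded_survival_measurable (mXt y s)).
  - by move=> w _; rewrite lee_fin mulr_ge0.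
  - by rewrite lee_fin expR_ge0.
move=> /(congr1 (fun x => c^-1%:E * x)%E).
by rewrite !muleA -!EFinM mulVf ?mul1e// gt_eqF// expR_gt0.
Qed.

End bounded.

Let cut (g : E -> R) k z := Order.min (g z) k%:R.
Let mcut g k : measurable_fun setT g -> measurable_fun setT (cut g k).
Proof. by move=> mg; exact: measurable_minr. Qed.
Let cut_ge0 (g : E -> R) k z : (forall z, 0 <= g z) -> 0 <= cut g k z.
Proof. by move=> g0; rewrite le_min g0/=. Qed.
Let cut_le (g : E -> R) k z : cut g k z <= k%:R.
Proof. by rewrite ge_min lexx orbT. Qed.

Section killing_theory.
Variable g : E -> R.
Hypothesis mg : measurable_fun setT g.
Hypothesis g0 : forall z, 0 <= g z.

Lemma killing_ge0 y s w : 0 <= killing g y s w.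
Proof. by apply: fine_ge0; exact: expeR_ge0. Qed.

Lemma killing_le1 y s w : killing g y s w <= 1.
Proof.
rewrite /killing; have : (0 <= path_integral g y s w)%E.
  by apply: integral_ge0 => v _; rewrite lee_fin.
case: path_integral => [r| |]//=; rewrite ?lee_fin => r0.
by rewrite -[leRHS]expR0 ler_expR oppr_le0.
Qed.

Let gk := cut g.
Let mgk k : measurable_fun setT (gk k). Proof. exact: mcut. Qed.
Let gk0 k z : 0 <= gk k z. Proof. exact: cut_ge0. Qed.
Let gkk k z : gk k z <= k%:R. Proof. exact: cut_le. Qed.

(** The truncated path integrals increase to the full one by monotone convergence, and [cvg_expRN]
    covers an infinite limit. *)
Lemma killing_cvg y s w : killing (gk n) y s w @[n --> \oo] --> killing g y s w.
Proof.
rewrite (_ : (fun n => killing (gk n) y s w) =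
    (fun n => expR (- fine (path_integral (gk n) y s w)))); last first.
  by apply/funext => n; have [] := bounded_killingE (mgk n) (@gk0 n) (@gkk n) y s w.
apply: cvg_expRN => [n|].
  by apply: fine_ge0; apply: integral_ge0 => v _; rewrite lee_fin.
rewrite (_ : (fun n => _) = (fun n => path_integral (gk n) y s w)); last first.
  apply/funext => n; rewrite fineK//.
  by have [] := bounded_killingE (mgk n) (@gk0 n) (@gkk n) y s w.
rewrite /path_integral.
rewrite [X in _ --> X](_ : _ = \int[mu]_(v in `[0%R, L])
    limn (fun n => (gk n (X y (s + v) w))%:E))%E.
  apply: cvg_monotone_convergence => //.
  - by move=> n; apply: measurable_funTS; exact: mpath.
  - by move=> n v _; rewrite lee_fin.
  - move=> v _ m n mn; rewrite lee_fin /gk /cut le_min ge_min lexx/=.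
    by rewrite ge_min ler_nat mn orbT.
apply: eq_integral => v _; apply/esym/cvg_lim => //.
(* The potential is finite at each state, so the truncation there is eventually inactive. *)
apply: cvg_near_cst; near=> n; congr _%:E; apply/min_idPl.
near: n; exact: nbhs_infty_ger.
Unshelve. all: by end_near. Qed.

Lemma measurable_killing y s : measurable_fun setT (killing g y s).
Proof.
apply: (measurable_fun_cvg (h := fun n => killing (gk n) y s)) => [n|w _].
  exact: bounded_killing_measurable (mgk n) (@gk0 n) (@gkk n) y s.
exact: killing_cvg.
Qed.

Lemma survivalE z : (\int[P]_w (killing g z 0 w)%:E)%E = (survival g z)%:E.
Proof.
rewrite /survival fineK// ge0_fin_numE; last first.
  by apply: integral_ge0 => w _; rewrite lee_fin killing_ge0.
rewrite (@le_lt_trans _ _ (\int[P]_w 1)%E)//; last first.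
  rewrite integral_cst// mul1e.
  by apply: le_lt_trans (probability_le1 P measurableT) _; rewrite ltry.
apply: ge0_le_integral => //.
- by move=> w _; rewrite lee_fin killing_ge0.
- by apply/measurable_EFinP; exact: measurable_killing.
- by move=> w _; rewrite lee_fin killing_le1.
Qed.

Lemma survival_ge0 z : 0 <= survival g z.
Proof. by apply: fine_ge0; apply: integral_ge0 => w _; rewrite lee_fin killing_ge0. Qed.

Lemma survival_le1 z : survival g z <= 1.
Proof.
rewrite -lee_fin -survivalE -[leRHS]mul1e
  -[X in (_ <= _ * X)%E](probability_setT P) -integral_cst//.
apply: ge0_le_integral => //.
- by move=> w _; rewrite lee_fin killing_ge0.
- by apply/measurable_EFinP; exact: measurable_killing.
- by move=> w _; rewrite lee_fin killing_le1.
Qed.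

End killing_theory.

Section survival_theory.
Variable g : E -> R.
Hypothesis mg : measurable_fun setT g.
Hypothesis g0 : forall z, 0 <= g z.
Let gk := cut g.
Let mgk k : measurable_fun setT (gk k). Proof. exact: mcut. Qed.
Let gk0 k z : 0 <= gk k z. Proof. exact: cut_ge0. Qed.
Let gkk k z : gk k z <= k%:R. Proof. exact: cut_le. Qed.

Let survival_cvg z : survival (gk n) z @[n --> \oo] --> survival g z.
Proof.
rewrite /survival; apply: fine_cvg; rewrite -survivalE//.
apply: (dominated_cvg measurableT (g := cst 1%E)) => //.
- move=> n; apply/measurable_EFinP.
  exact: bounded_killing_measurable (mgk n) (@gk0 n) (@gkk n) z 0.
- by move=> w _; apply: cvg_EFin; [exact: nearW|exact: killing_cvg].
- exact: finite_measure_integrable_cst.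
- move=> n w _; rewrite /= lee_fin ger0_norm ?killing_ge0//.
  by apply: killing_le1 => z'; exact: gk0.
Qed.

Lemma measurable_survival : measurable_fun setT (survival g).
Proof.
apply: (measurable_fun_cvg (h := fun n => survival (gk n))) => [n|z _].
  exact: bounded_survival_measurable (mgk n) (@gk0 n) (@gkk n).
exact: survival_cvg.
Qed.

(** The truncation level is sent to infinity on both sides. Killing factors and survival functions
    are at most 1, so the integrable weight [Z] dominates. *)
Lemma markov_killing y s (Z : Om -> R) : 0 <= s ->
  measurable_fun setT (Z : g_sigma_algebraType (G y s) -> R) -> (forall w, 0 <= Z w) ->
  P.-integrable setT (EFin \o Z) ->
  (\int[P]_w (Z w * killing g y s w)%:E =
   \int[P]_w (Z w * survival g (X y s w))%:E)%E.
Proof.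
move=> s0 mZ Z0 iZ; have [_ Gm2 _ _] := GX y.
have mZT : measurable_fun [set: Om] Z.
  by move=> _ B mB; have := mZ measurableT B mB; rewrite !setTI => /Gm2.
have cvg1 : (\int[P]_w (Z w * killing (gk n) y s w)%:E)%E @[n --> \oo] -->
    (\int[P]_w (Z w * killing g y s w)%:E)%E.
  apply: (dominated_cvg measurableT (g := EFin \o Z)) => //.
  - move=> n; apply/measurable_EFinP; apply: measurable_funM => //.
    exact: bounded_killing_measurable (mgk n) (@gk0 n) (@gkk n) y s.
  - move=> w _; apply: cvg_EFin; first exact: nearW.
    by apply: cvgMr; exact: killing_cvg.
  - move=> n w _; rewrite /= lee_fin ger0_norm ?mulr_ge0 ?killing_ge0//.
    by rewrite ler_piMr//; apply: killing_le1 => z; exact: gk0.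
have cvg2 : (\int[P]_w (Z w * survival (gk n) (X y s w))%:E)%E @[n --> \oo] -->
    (\int[P]_w (Z w * survival g (X y s w))%:E)%E.
  apply: (dominated_cvg measurableT (g := EFin \o Z)) => //.
  - move=> n; apply/measurable_EFinP; apply: measurable_funM => //.
    by apply: (measurableT_comp _ (mXt y s));
      exact: bounded_survival_measurable (mgk n) (@gk0 n) (@gkk n).
  - move=> w _; apply: cvg_EFin; first exact: nearW.
    by apply: cvgMr; exact: survival_cvg.
  - move=> n w _; rewrite /= lee_fin ger0_norm ?mulr_ge0 ?survival_ge0//.
    by rewrite ler_piMr//; apply: survival_le1 => // z; exact: gk0.
rewrite -(cvg_lim _ cvg1)// -(cvg_lim _ cvg2)//; congr (limn _).
by apply/funext => n; exact: (bounded_markov_killing (mgk n) (@gk0 n) (@gkk n) s0 mZ Z0).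
Qed.

End survival_theory.
End feynman_kac.

(** * Shifted time windows, versions of conditional expectations, and multiplicativity of killing *)

Section lebesgue_shift.
Context (R : realType).
Local Open Scope ereal_scope.
Local Notation mu := (@lebesgue_measure R).

Let measurable_shift (s : R) :
  measurable_fun setT ((fun v => s + v)%R : measurableTypeR R -> measurableTypeR R).
Proof. exact: (measurable_funD (measurable_cst s) (@measurable_id _ _ _)). Qed.

Let shifted (s : R) : {measure set (measurableTypeR R) -> \bar R}.
Proof.
refine (pushforward mu ((fun v => s + v)%R : measurableTypeR R -> measurableTypeR R)
  : {measure set (measurableTypeR R) -> \bar R}).
exact: measurable_shift.
Defined.

(** By uniqueness of Lebesgue measure it suffices to compare the two measures on half-open
    intervals. *)
Lemma lebesgue_measure_shift (s : R) (A : set R) : measurable A ->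
  pushforward mu ((fun v => s + v)%R : measurableTypeR R -> measurableTypeR R) A = mu A.
Proof.
move=> mA; apply/esym/(lebesgue_measure_unique (mu := shifted s)) => //.
move=> _ [[a b]] _ <-; rewrite /shifted /= /pushforward.
rewrite (_ : _ @^-1` _ = `](a - s)%R, (b - s)%R]%classic); last first.
  by apply/seteqP; split => v /=; rewrite !in_itv/= ltrBlDl lerBrDl.
rewrite !lebesgue_measure_itv/= !lte_fin ltrD2r.
by case: ifP => // _; rewrite -!EFinB opprB addrA subrK.
Qed.

Lemma ge0_integral_shift (s t : R) (f : R -> \bar R) :
  measurable_fun setT f -> (forall v, 0 <= f v) ->
  \int[mu]_(v in `[s, t]) f v = \int[mu]_(v in `[0%R, (t - s)%R]) f (s + v)%R.
Proof.
move=> mf f0.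
rewrite (_ : `[0%R, (t - s)%R]%classic =
    ((fun v => s + v)%R : measurableTypeR R -> measurableTypeR R) @^-1` `[s, t]); last first.
  by apply/seteqP; split => v /=; rewrite !in_itv/= lerDl lerBrDl.
rewrite -(ge0_integral_pushforward (measurable_shift s) mu (f := f))//=; last first.
  exact: measurable_funS mf.
by apply: eq_measure_integral => //= A mA AS; exact/esym/lebesgue_measure_shift.
Qed.

End lebesgue_shift.

Section conditional_expectation.
Context (R : realType) d (Om : measurableType d) (P : probability Om R).
Variable G : set (set Om).
Hypothesis Gmeas : <<s G >> `<=` measurable.
Local Open Scope ereal_scope.

Lemma sub_sigma_algebra_measurable_fun dT (T : measurableType dT) (Z : Om -> T) :
  (forall B, measurable B -> <<s G >> (Z @^-1` B)) ->
  measurable_fun [set: g_sigma_algebraType G] (Z : g_sigma_algebraType G -> T).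
Proof. by move=> GZ _ B mB; rewrite setTI; exact: GZ. Qed.

Lemma sub_sigma_algebra_measurable_funT dT (T : measurableType dT) (Z : Om -> T) :
  measurable_fun [set: g_sigma_algebraType G] (Z : g_sigma_algebraType G -> T) ->
  measurable_fun [set: Om] Z.
Proof. by move=> mZ _ B mB; have := mZ measurableT B mB; rewrite !setTI => /Gmeas. Qed.

(** The event that [Y] exceeds [Z] belongs to the sub-sigma-algebra, so [Y - Z] has integral 0 over
    it. Being positive there, it forces the event to be null. *)
Let cond_exp_le (Y Z : Om -> R) :
  P.-integrable setT (EFin \o Y) -> P.-integrable setT (EFin \o Z) ->
  (forall B, measurable B -> <<s G >> (Y @^-1` B)) ->
  (forall B, measurable B -> <<s G >> (Z @^-1` B)) ->
  (forall A, <<s G >> A -> \int[P]_(w in A) (Y w)%:E = \int[P]_(w in A) (Z w)%:E) ->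
  {ae P, forall w, (Y w <= Z w)%R}.
Proof.
move=> iY iZ /sub_sigma_algebra_measurable_fun GY /sub_sigma_algebra_measurable_fun GZ YZ.
pose A := [set w | (0 < Y w - Z w)%R].
have GA : <<s G >> A.
  have := measurable_funB GY GZ measurableT (measurable_itv `]0%R, +oo[).
  rewrite setTI (_ : _ @^-1` _ = A)//.
  by apply/seteqP; split=> w; rewrite /A /= in_itv/= andbT.
have mA := Gmeas GA.
have iYZ : \int[P]_(w in A) (Y w - Z w)%:E = 0.
  under eq_integral do rewrite EFinB.
  rewrite integralB_EFin//; [|exact: integrableS iY|exact: integrableS iZ].
  rewrite YZ// subee//; apply: integrable_fin_num => //; exact: integrableS iZ.
have : ae_eq P A (EFin \o (fun w => Y w - Z w)%R) (cst 0).
  apply/(ae_eq_integral_abs P mA).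
    by apply/measurable_EFinP/measurable_funTS/measurable_funB;
      exact: sub_sigma_algebra_measurable_funT.
  rewrite -[RHS]iYZ; apply: eq_integral => w; rewrite inE /A/= => YZw.
  by rewrite ger0_norm// ltW.
apply: filterS => w /= h; rewrite leNgt; apply/negP => ZY.
have YZw : (0 < Y w - Z w)%R by rewrite subr_gt0.
by have := h YZw => -[] /eqP; rewrite gt_eqF.
Qed.

(** One explicit version determines all others up to null sets, by [cond_exp_le] in both directions.
    The price formulas are reduced to exhibiting such a version. *)
Lemma cond_expP (H Y0 : Om -> R) :
  P.-integrable setT (EFin \o H) -> P.-integrable setT (EFin \o Y0) ->
  (forall B, measurable B -> <<s G >> (Y0 @^-1` B)) ->
  (forall A, <<s G >> A -> \int[P]_(w in A) (Y0 w)%:E = \int[P]_(w in A) (H w)%:E) ->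
  forall Y, cond_exp P <<s G >> H Y <-> {ae P, forall w, Y w = Y0 w}.
Proof.
move=> iH iY0 GY0 Y0H Y; split=> [[_ [Z [iZ GZ ZH YZ]]]|YY0]; last first.
  by split=> //; exists Y0.
have h1 := cond_exp_le iZ iY0 GZ GY0 (fun A GA => etrans (ZH A GA) (esym (Y0H A GA))).
have h2 := cond_exp_le iY0 iZ GY0 GZ (fun A GA => etrans (Y0H A GA) (esym (ZH A GA))).
by apply: filterS3 YZ h1 h2 => w -> Z1 Z2; apply/eqP; rewrite eq_le Z1 Z2.
Qed.

End conditional_expectation.

(** Reading the derivative off a sequence limits the exceptional null sets to countably many. *)
Lemma derive1_cvg_invn (R : realType) (f : R -> R) (a : R) : derivable f a 1 ->
  n.+1%:R * (f (n.+1%:R^-1 + a) - f a) @[n --> \oo] --> derive1 f a.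
Proof.
move=> df; have h : h^-1 *: (f (h + a) - f a) @[h --> 0^'] --> derive1 f a.
  move: df; rewrite /derivable; under eq_fun do rewrite /= [_ *: 1]mulr1.
  exact.
have -> : (fun n => n.+1%:R * (f (n.+1%:R^-1 + a) - f a)) =
    (fun n => (n.+1%:R^-1)^-1 *: (f (n.+1%:R^-1 + a) - f a)).
  by apply/funext => n; rewrite invrK.
apply: (cvgr_dnbhsP (fun h => h^-1 *: (f (h + a) - f a)) 0 (derive1 f a)).1 h _ _.
by split; [move=> n; rewrite invr_neq0|exact: cvg_harmonic].
Qed.

Lemma ln_inv (R : realType) (a : R) : 0 <= a -> ln a^-1 = - ln a.
Proof.
(* At 0 the identity rests on the conventions that the inverse and the logarithm of 0 are 0; it is
   applied to ratios that may vanish. *)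
rewrite le_eqVlt => /predU1P[<-|a0]; first by rewrite invr0 ln0// oppr0.
by rewrite lnV.
Qed.

Section killing_additivity.
Context (R : realType) d (Om : measurableType d) dE (E : measurableType dE).
Variable X : E -> R -> Om -> E.
Hypothesis mX : forall y, measurable_fun setT (fun p : R * Om => X y p.1 p.2).
Variable g : E -> R.
Hypothesis mg : measurable_fun setT g.
Hypothesis g0 : forall z, 0 <= g z.

(** The path integral is additive over adjacent windows; if one of the two pieces is infinite, both
    sides are 0. *)
Lemma killingD a b y w : 0 <= a -> 0 <= b ->
  killing X (a + b) g y 0 w = killing X a g y 0 w * killing X b g y a w.
Proof.
move=> a0 b0.
have mpath : measurable_fun setT (fun v : R => (g (X y v w))%:E).
  by apply/measurable_EFinP/(measurableT_comp mg); exact: (measurable_fun_pair1 w (mX y)).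
have split_path : (path_integral X (a + b) g y 0 w =
    path_integral X a g y 0 w + path_integral X b g y a w)%E.
  rewrite /path_integral; under eq_integral do rewrite add0r.
  under [in RHS]eq_integral do rewrite add0r.
  rewrite (ge0_integral_itv_split (b := a)) ?lerDl//; last first.
    by move=> v; rewrite lee_fin.
  congr (_ + _)%E; rewrite ge0_integral_shift//; last by move=> v; rewrite lee_fin.
  by rewrite addrC addKr.
have pos L s : (0 <= path_integral X L g y s w)%E.
  by apply: integral_ge0 => v _; rewrite lee_fin.
rewrite /killing split_path; move: (pos a 0) (pos b a).
case: (path_integral X a g y 0 w) => [r| |]//;
  case: (path_integral X b g y a w) => [r'| |]//= _ _;
  by rewrite ?mulr0 ?mul0r// opprD expRD.
Qed.

Lemma killing_nonincreasing a b y w : 0 <= a -> a <= b ->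
  killing X b g y 0 w <= killing X a g y 0 w.
Proof.
move=> a0 ab; rewrite -(subrK a b) addrC killingD ?subr_ge0//.
by rewrite ler_piMr ?killing_ge0// killing_le1.
Qed.

End killing_additivity.

(** * Bond prices *)

Section clipped_process.
Context (R : realType) d (Om : measurableType d) (P : probability Om R).
Context (S : ptopologicalType) (X : S -> R -> Om -> borel S).
Hypothesis X_markov : markov_process P X.
Context (V : borel S -> R).
Hypothesis V_meas : measurable_fun [set: borel S] V.
Hypothesis V_ge0 : forall y, 0 <= V y.
Local Notation mu := (@lebesgue_measure R).

(* The process is only measurable at times [t >= 0]; this version is measurable
   at all times. *)
Definition even_extension (y : borel S) (t : R) : Om -> borel S := X y `|t|.
Local Notation Xe := even_extension.

Let XeE y t : 0 <= t -> Xe y t = X y t.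
Proof. by move=> t0; rewrite /Xe ger0_norm. Qed.

Lemma measurable_even_extension y :
  measurable_fun setT (fun p : R * Om => Xe y p.1 p.2).
Proof.
have [mX _ _ _] := X_markov.
have mabs : measurable_fun [set: R * Om] (fun p : R * Om => (`|p.1|, p.2)).
  by apply: measurable_fun_pair; [exact: measurableT_comp|exact: measurable_snd].
have := measurable_comp _ _ (mX y) mabs; apply.
- exact: measurableX.
- by move=> _ [p _ <-]; split => //=; rewrite in_itv/= andbT.
Qed.

Lemma measurable_even_transition (B : set (borel S)) : measurable B ->
  measurable_fun setT (fun p : R * borel S => P (Xe p.2 p.1 @^-1` B)).
Proof.
move=> mB; have [_ _ mt _] := X_markov.
have mabs : measurable_fun [set: R * borel S] (fun p : R * borel S => (`|p.1|, p.2)).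
  by apply: measurable_fun_pair; [exact: measurableT_comp|exact: measurable_snd].
have := measurable_comp _ _ (mt B mB) mabs; apply.
- exact: measurableX.
- by move=> _ [p _ <-]; split => //=; rewrite in_itv/= andbT.
Qed.

Lemma even_extension0 y : {ae P, forall w, Xe y 0 w = y}.
Proof. by rewrite XeE//; case: X_markov. Qed.

Lemma measurable_section y t : 0 <= t -> measurable_fun setT (X y t).
Proof.
by move=> t0; rewrite -XeE//; exact: (measurable_fun_pair2 t (measurable_even_extension y)).
Qed.

(** The property [markov_wrt] speaks of an almost sure version; after integration over an event of
    the past the version can be replaced by the transition probability itself. *)
Lemma markov_wrt_generates y (G : R -> set (set Om)) :
  (forall s t, s <= t -> G s `<=` G t) ->
  (forall s, G s `<=` measurable) ->
  (forall s (B : set (borel S)), 0 <= s -> measurable B -> G s (X y s @^-1` B)) ->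
  markov_wrt P X y (fun t => <<s G t >>) ->
  generates_markov_filtration P Xe y G.
Proof.
move=> Gmono Gm GX mkv.
have Gs s : <<s G s >> `<=` measurable.
  by apply: smallest_sub; [exact: sigma_algebra_measurable|exact: Gm].
split=> // [s B s0 mB|s u A B s0 u0 GA mB].
  by rewrite XeE//; apply: sub_gen_smallest; exact: GX.
have su0 : 0 <= s + u by rewrite addr_ge0.
have mXB : measurable (X y (s + u) @^-1` B).
  by rewrite -[X in measurable X]setTI; exact: measurable_section.
have [_ [Z [iZ GZ ZA YZ]]] := mkv s u B s0 u0 mB.
rewrite XeE// setIC -integral_indic//; last exact: (Gs s).
rewrite -ZA//; apply: ae_eq_integral.
- exact: (Gs s).
- by apply: measurable_funTS; case/integrableP: iZ.
- apply: measurable_funTS.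
  apply: (measurableT_comp (f := fun z => P (Xe z u @^-1` B))).
    exact: (measurable_fun_pair2 u (measurable_even_transition mB)).
  exact: measurable_section.
- apply: filterS YZ => w YZw _ /=; rewrite -YZw /transition XeE// XeE// fineK//.
  by apply: fin_num_measure; rewrite -[X in measurable X]setTI; exact: measurable_section.
Qed.

Definition natural_generators (y : borel S) (t : R) : set (set Om) :=
  [set A | exists s : R, 0 <= s <= t /\
    exists2 B : set (borel S), measurable B & A = X y s @^-1` B].

Lemma natural_generates_markov_filtration y :
  generates_markov_filtration P Xe y (natural_generators y).
Proof.
apply: markov_wrt_generates.
- move=> s t st A [r [/andP[r0 rs] BA]]; exists r; split => //.
  by rewrite r0 (le_trans rs).
- move=> s _ [r [/andP[r0 _] [B mB ->]]].
  by rewrite -[X in measurable X]setTI; exact: measurable_section.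
- by move=> s B s0 mB; exists s; rewrite s0 lexx; split => //; exists B.
- by case: X_markov => _ _ _; exact.
Qed.

Lemma discountE y s L w : 0 <= s -> 0 <= L ->
  discount V (X y) s (s + L) w = killing Xe L V y s w.
Proof.
move=> s0 L0; rewrite /discount /killing /path_integral; congr (fine (expeR (- _)%E)).
transitivity (\int[mu]_(u in `[s, (s + L)%R]) (V (Xe y u w))%:E)%E.
  apply: eq_integral => u; rewrite inE/= in_itv/= => /andP[su _].
  by rewrite XeE// (le_trans s0).
rewrite ge0_integral_shift; last 2 first.
- apply/measurable_EFinP/(measurableT_comp V_meas).
  exact: (measurable_fun_pair1 w (measurable_even_extension y)).
- by move=> v; rewrite lee_fin.
by rewrite addrC addKr.
Qed.

Lemma qE L y : 0 <= L -> q P X V L y = survival P Xe L V y.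
Proof.
move=> L0; rewrite /q /survival unlock; congr fine; apply: eq_integral => w _.
by rewrite -[in LHS](add0r L) discountE.
Qed.

Lemma qhat_killing s L y : 0 <= s -> 0 <= L ->
  qhat P X V (s + L) s y = fine (\int[P]_w (killing Xe L V y s w)%:E)%E.
Proof.
move=> s0 L0; rewrite /qhat unlock; congr fine; apply: eq_integral => w _.
by rewrite discountE.
Qed.

(** This is [markov_killing] with weight 1. It turns [qhat] into a transition integral of a survival
    function, from which its measurability, its bound and the default-free price follow. *)
Lemma qhat_survival s L y : 0 <= s -> 0 <= L ->
  (qhat P X V (s + L) s y)%:E = (\int[P]_w (survival P Xe L V (X y s w))%:E)%E.
Proof.
move=> s0 L0; rewrite qhat_killing//.
have h := markov_killing measurable_even_extension measurable_even_transition
  even_extension0 natural_generates_markov_filtration L V_meas V_ge0 (y := y) s0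
  (measurable_cst (1 : R)) (fun=> ler01) (finite_measure_integrable_cst P 1 measurableT).
have -> : (\int[P]_w (survival P Xe L V (X y s w))%:E =
    \int[P]_w (1 * survival P Xe L V (Xe y s w))%:E)%E.
  by apply: eq_integral => w _; rewrite mul1r XeE.
rewrite -h; under [RHS]eq_integral do rewrite mul1r.
rewrite fineK// ge0_fin_numE; last first.
  by apply: integral_ge0 => w _; rewrite lee_fin killing_ge0.
apply: (@le_lt_trans _ _ (\int[P]_w 1)%E).
  apply: ge0_le_integral => //.
  - by move=> w _; rewrite lee_fin killing_ge0.
  - apply/measurable_EFinP.
    exact: (measurable_killing measurable_even_extension L V_meas V_ge0).
  - by move=> w _; rewrite lee_fin killing_le1.
rewrite integral_cst// mul1e.
by apply: le_lt_trans (probability_le1 P measurableT) _; rewrite ltry.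
Qed.

End clipped_process.

(** * Conditional expectations given the market *)

Section market.
Context (R : realType) d (Om : measurableType d) (P : probability Om R).
Context (S : ptopologicalType) (X : S -> R -> Om -> borel S).
Hypothesis X_markov : markov_process P X.
Context (V : borel S -> R).
Hypothesis V_meas : measurable_fun [set: borel S] V.
Hypothesis V_ge0 : forall y, 0 <= V y.
Context (x : S) (tau : Om -> \bar R).
Hypothesis tau_meas : measurable_fun [set: Om] tau.
Hypothesis X_market_markov : markov_wrt P X x (market_filtration (X x) tau).
Hypothesis tau_law : forall t, 0 <= t ->
  cond_exp P (natural_filtration (X x) t)
    (\1_[set w | (t%:E < tau w)%E]) (discount V (X x) 0 t).

Local Notation Xe := (even_extension X).
Local Notation Surv L := (survival P Xe L V).
Local Notation mXe := (measurable_even_extension X_markov).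
Local Notation mtr := (measurable_even_transition X_markov).
Local Notation GXe := (natural_generates_markov_filtration X_markov).

Let XeE y t : 0 <= t -> Xe y t = X y t.
Proof. by move=> t0; rewrite /even_extension ger0_norm. Qed.

Let mSurv L : measurable_fun setT (Surv L).
Proof. exact: (measurable_survival mXe mtr (even_extension0 X_markov) GXe L V_meas V_ge0). Qed.

Let Surv_le1 L z : Surv L z <= 1.
Proof. exact: (survival_le1 P mXe L V_meas V_ge0). Qed.

Let integrable01 (f : Om -> R) : measurable_fun setT f -> (forall w, 0 <= f w) ->
  (forall w, f w <= 1) -> P.-integrable setT (EFin \o f).
Proof.
move=> mf f0 f1; apply: (le_integrable measurableT (g := EFin \o cst 1)) => //.
- exact/measurable_EFinP.
- by move=> w _; rewrite /= lee_fin ger0_norm// normr1.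
- exact: finite_measure_integrable_cst.
Qed.

Let integral_indic_mul (A : set Om) (f : Om -> \bar R) :
  (\int[P]_(w in A) f w = \int[P]_w ((\1_A w)%:E * f w))%E.
Proof.
rewrite integral_mkcond; apply: eq_integral => w _; rewrite patchE indicE.
by case: (w \in A); rewrite ?mul1e ?mul0e.
Qed.

Definition market_generators (t : R) : set (set Om) :=
  [set A | exists s : R, 0 <= s <= t /\
     ((exists2 B : set (borel S), measurable B & A = X x s @^-1` B) \/
      A = [set w | (tau w <= s%:E)%E])].

Let measurable_default s : measurable [set w | (tau w <= s%:E)%E].
Proof.
have := tau_meas measurableT (emeasurable_itv `]-oo, s%:E]).
by rewrite setTI; congr (measurable _); apply/seteqP; split=> w /=; rewrite in_itv.
Qed.

Let measurable_alive s : measurable [set w | (s%:E < tau w)%E].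
Proof.
rewrite (_ : [set w | _] = ~` [set w | (tau w <= s%:E)%E]).
  exact: measurableC.
by apply/seteqP; split=> w /=; rewrite ltNge => /negP.
Qed.

Lemma market_generates_markov_filtration :
  generates_markov_filtration P Xe x market_generators.
Proof.
apply: markov_wrt_generates => //.
- move=> s t st A [r [/andP[r0 rs] BA]]; exists r; split => //.
  by rewrite r0 (le_trans rs).
- move=> s A [r [/andP[r0 _]]] [[B mB ->]|->]; last exact: measurable_default.
  by rewrite -[X in measurable X]setTI; exact: (measurable_section X_markov).
- by move=> s B s0 mB; exists s; rewrite s0 lexx; split => //; left; exists B.
Qed.

Let alive_indic t w : \1_[set w' | (t%:E < tau w')%E] w = (t%:E < tau w)%E%:R :> R.
Proof.
by rewrite indicE; congr (nat_of_bool _)%:R; apply/idP/idP; rewrite inE.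
Qed.

(* Before default, the market only knows the past of the state variable. *)
Let market_trace t A : <<s market_generators t >> A ->
  exists2 A', <<s natural_generators X x t >> A' &
    A `&` [set w | (t%:E < tau w)%E] = A' `&` [set w | (t%:E < tau w)%E].
Proof.
set D := [set w | _].
have natS : sigma_algebra setT <<s natural_generators X x t >>.
  exact: smallest_sigma_algebra.
have [nat0 natC natU] := natS.
(* The events with the required property form a sigma-algebra, so only generators need checking.
   Default by a time [r <= t] has empty trace on [D]. *)
pose C := [set A | exists2 A', <<s natural_generators X x t >> A' & A `&` D = A' `&` D].
suff : <<s market_generators t >> `<=` C by apply.
apply: smallest_sub; first split.
- by exists set0.
- move=> B [A' GA' BA']; exists (setT `\` A'); first exact: natC.
  rewrite !setTD; apply/seteqP; split=> w [nBw Dw]; split=> // A'w; apply: nBw.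
    by have : (A' `&` D) w by []; rewrite -BA' => -[].
  by have : (B `&` D) w by []; rewrite BA' => -[].
- move=> F CF; pose F' n := projT1 (cid2 (CF n)).
  have F'P n : <<s natural_generators X x t >> (F' n) /\ F n `&` D = F' n `&` D.
    by rewrite /F'; case: cid2.
  exists (\bigcup_n F' n); first by apply: natU => n; exact: (F'P n).1.
  by rewrite !setI_bigcupl; apply: eq_bigcupr => n _; exact: (F'P n).2.
- move=> B [r [/andP[r0 rt] [[B' mB' ->]|->]]].
    exists (X x r @^-1` B') => //; apply: sub_gen_smallest.
    by exists r; rewrite r0 rt; split => //; exists B'.
  exists set0 => //; rewrite set0I; apply/seteqP; split=> // w [/= taur].
  by rewrite /D/= ltNge (le_trans taur)// lee_fin.
Qed.

Let natural_measurable t : <<s natural_generators X x t >> `<=` measurable.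
Proof. by case: (GXe x) => _ + _ _; exact. Qed.

Let market_measurable t : <<s market_generators t >> `<=` measurable.
Proof. by case: market_generates_markov_filtration => _ + _ _; exact. Qed.

Let Surv_ge0 L z : 0 <= Surv L z. Proof. exact: survival_ge0. Qed.

Let alive_ge0 t w : 0 <= \1_[set w' | (t%:E < tau w')%E] w :> R.
Proof. by rewrite indicE. Qed.

Let alive_measurable t : measurable_fun setT (\1_[set w' | (t%:E < tau w')%E] : Om -> R).
Proof. exact: measurable_indic. Qed.

Let mkill L s : measurable_fun setT (killing Xe L V x s).
Proof. exact: (measurable_killing mXe). Qed.

(** The discount factor is not known to be measurable for the past of [X], because the joint
    measurability of the paths refers to the full sigma-algebra. A version [Z] that is measurable
    for this past is therefore carried along. *)
Let tau_version r : 0 <= r -> exists Z : Om -> R,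
  [/\ P.-integrable setT (EFin \o Z),
      measurable_fun setT (Z : g_sigma_algebraType (natural_generators X x r) -> R),
      forall A, <<s natural_generators X x r >> A -> (\int[P]_(w in A) (Z w)%:E =
        \int[P]_(w in A) (\1_[set w' | (r%:E < tau w')%E] w)%:E)%E
    & {ae P, forall w, killing Xe r V x 0 w = Z w}].
Proof.
move=> r0; have [_ [Z [iZ GZ ZA DZ]]] := tau_law r0.
exists Z; split=> //; first exact: sub_sigma_algebra_measurable_fun.
by apply: filterS DZ => w <-; rewrite -(discountE X_markov)// add0r.
Qed.

Let tau_weight r (h : g_sigma_algebraType (natural_generators X x r) -> \bar R) :
  0 <= r -> measurable_fun setT h -> (forall w, 0 <= h w)%E ->
  (\int[P]_w (h w * (\1_[set w' | (r%:E < tau w')%E] w)%:E) =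
   \int[P]_w (h w * (killing Xe r V x 0 w)%:E))%E.
Proof.
move=> r0 mh h0; have [Z [iZ mZ ZA DZ]] := tau_version r0.
apply: (sub_sigma_algebra_integral_eq (G := natural_generators X x r)) => //.
- exact/measurable_EFinP.
- exact/measurable_EFinP.
- by move=> w; rewrite lee_fin killing_ge0.
move=> A GA; rewrite -ZA//; have mA := natural_measurable GA.
apply: ae_eq_integral => //.
- by apply: measurable_funTS; case/integrableP: iZ.
- by apply: measurable_funTS; exact/measurable_EFinP.
- by apply: filterS DZ => w Dw _ /=; rewrite Dw.
Qed.

(** The past discount factor has to become part of the weight in [markov_killing]. It is replaced by
    the absolute value of its version [Z], which is measurable for the past, nonnegative everywhere
    and integrable. *)
Let markov_weight r L (h : Om -> R) : 0 <= r ->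
  measurable_fun setT (h : g_sigma_algebraType (natural_generators X x r) -> R) ->
  (forall w, 0 <= h w) -> (forall w, h w <= 1) ->
  (\int[P]_w (h w * killing Xe r V x 0 w * killing Xe L V x r w)%:E =
   \int[P]_w (h w * killing Xe r V x 0 w * Surv L (X x r w))%:E)%E.
Proof.
move=> r0 mh h0 h1; have [Z [iZ mZ ZA DZ]] := tau_version r0.
have mhT : measurable_fun [set: Om] h.
  exact: (sub_sigma_algebra_measurable_funT (@natural_measurable r) mh).
have mZT : measurable_fun [set: Om] Z.
  exact: (sub_sigma_algebra_measurable_funT (@natural_measurable r) mZ).
have mW : measurable_fun setT
    ((fun w => h w * `|Z w|) : g_sigma_algebraType (natural_generators X x r) -> R).
  by apply: measurable_funM => //; exact: measurableT_comp.
have replace_version (f : Om -> R) : measurable_fun setT f ->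
    (\int[P]_w (h w * killing Xe r V x 0 w * f w)%:E =
     \int[P]_w (h w * `|Z w| * f w)%:E)%E.
  move=> mf; apply: ae_eq_integral => //.
  - by apply/measurable_EFinP; do 2 apply: measurable_funM => //.
  - apply/measurable_EFinP; do 2 apply: measurable_funM => //.
    exact: measurableT_comp.
  - by apply: filterS DZ => w Dw _ /=; rewrite -Dw ger0_norm// killing_ge0.
rewrite replace_version// replace_version; last first.
  by apply: (measurableT_comp (mSurv L)); exact: (measurable_section X_markov).
rewrite -(XeE x r0).
apply: (markov_killing mXe mtr (even_extension0 X_markov) GXe L V_meas V_ge0) => //.
- by move=> w; rewrite mulr_ge0.
- apply: (le_integrable measurableT (g := EFin \o Z)) => //.
  + apply/measurable_EFinP; apply: measurable_funM => //.
    exact: measurableT_comp.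
  + by move=> w _; rewrite /= lee_fin normrM normr_id ger0_norm// ler_piMl.
Qed.

Let measurable_state t r L : 0 <= t -> t <= r ->
  measurable_fun setT
    ((fun w => Surv L (X x t w)) : g_sigma_algebraType (natural_generators X x r) -> R).
Proof.
move=> t0 tr; apply: (measurableT_comp (mSurv L)) => _ B mB; rewrite setTI.
by apply: sub_gen_smallest; exists t; rewrite t0 tr; split => //; exists B.
Qed.

(** Both sides equal the integral, over an event of the past of [X], of the same discount factor for
    the window [0, L + T]. *)
Lemma defaultable_payoff_integral L t T A : 0 <= L -> 0 <= t -> t <= T ->
  <<s market_generators t >> A ->
  (\int[P]_(w in A) (\1_[set w' | (t%:E < tau w')%E] w * Surv (L + T - t) (X x t w))%:E =
   \int[P]_(w in A) (\1_[set w' | (T%:E < tau w')%E] w * Surv L (X x T w))%:E)%E.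
Proof.
move=> L0 t0 tT GA; have T0 := le_trans t0 tT.
have [A' GA' AA'] := market_trace GA.
have AA'w r w : t <= r -> (\1_A w * \1_[set w' | (r%:E < tau w')%E] w =
    \1_A' w * \1_[set w' | (r%:E < tau w')%E] w :> R).
  move=> tr; rewrite alive_indic; case: ltP => [rw|]; last by rewrite !mulr0.
  have tw : (t%:E < tau w)%E by rewrite (le_lt_trans _ rw)// lee_fin.
  rewrite !mulr1 !indicE; congr (nat_of_bool _)%:R; apply/idP/idP; rewrite !inE => Aw.
    by have [] : (A' `&` [set w | (t%:E < tau w)%E]) w by rewrite -AA'.
  by have [] : (A `&` [set w | (t%:E < tau w)%E]) w by rewrite AA'.
have m1 r : t <= r -> measurable_fun setT
    (\1_A' : g_sigma_algebraType (natural_generators X x r) -> R).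
  move=> tr; apply: measurable_indic; case: (GXe x) => + _ _ _ => /(_ t r tr) sub.
  by move: GA'; apply: sub_smallest2r => //; exact: smallest_sigma_algebra.
(* The law of [tau] trades the indicator of survival to [r] for the discount over [0, r], and the
   Markov property trades the survival function for the discount over [r, r + M]. *)
have step r M : 0 <= r -> t <= r -> 
    (\int[P]_(w in A) (\1_[set w' | (r%:E < tau w')%E] w * Surv M (X x r w))%:E =
     \int[P]_w (\1_A' w * killing Xe r V x 0 w * killing Xe M V x r w)%:E)%E.
  move=> r0 tr; rewrite integral_indic_mul (markov_weight M r0 (m1 r tr)); last 2 first.
  - by move=> w; rewrite indicE.
  - by move=> w; rewrite indicE lern1; case: (_ \in _).
  transitivity (\int[P]_w ((\1_A' w * Surv M (X x r w))%:E *
      (\1_[set w' | (r%:E < tau w')%E] w)%:E))%E.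
    by apply: eq_integral => w _; rewrite -!EFinM mulrA AA'w// mulrAC.
  rewrite tau_weight//.
  - by apply: eq_integral => w _; rewrite -EFinM mulrAC.
  - apply/measurable_EFinP; apply: measurable_funM; first exact: m1.
    exact: measurable_state.
  - by move=> w; rewrite lee_fin mulr_ge0// indicE.
(* The split at [t] and the split at [T] multiply to the same factor, since t + (L + T - t) = T +
   L. *)
rewrite (step t _ t0 (lexx t)) (step T _ T0 tT); apply: eq_integral => w _.
congr _%:E; rewrite -!mulrA; congr (_ * _).
have LTt0 : 0 <= L + T - t by rewrite -addrA addr_ge0// subr_ge0.
rewrite -(killingD mXe V_meas V_ge0 x w t0 LTt0) -(killingD mXe V_meas V_ge0 x w T0 L0).
by congr (killing Xe _ V x 0 w); ring.
Qed.

(** The Markov property relative to the market carries [Surv L] from [T] back to [t]; by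
    [qhat_survival] its transition integral over the elapsed time [T - t] is [qhat]. *)
Lemma default_free_payoff_integral L t T A : 0 <= L -> 0 <= t -> t <= T ->
  <<s market_generators t >> A ->
  (\int[P]_(w in A) (qhat P X V (L + T - t) (T - t) (X x t w))%:E =
   \int[P]_(w in A) (Surv L (X x T w))%:E)%E.
Proof.
move=> L0 t0 tT GA; have T0 := le_trans t0 tT; have u0 : 0 <= T - t by rewrite subr_ge0.
have := markov_integral mXe mtr market_generates_markov_filtration (s := t) (u := T - t)
  (g := EFin \o Surv L) (Z := EFin \o \1_A).
rewrite (_ : t + (T - t) = T); last by ring.
rewrite XeE// XeE// => h.
have mA : measurable_fun setT
    ((EFin \o \1_A) : g_sigma_algebraType (market_generators t) -> \bar R).
  exact/measurable_EFinP/measurable_indic.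
rewrite [LHS]integral_indic_mul [RHS]integral_indic_mul.
transitivity (\int[P]_w ((EFin \o \1_A) w * (EFin \o Surv L) (X x T w)))%E; last by [].
rewrite h; first last.
- by move=> w; rewrite lee_fin indicE.
- exact: mA.
- by move=> z; rewrite lee_fin.
- exact/measurable_EFinP.
- exact: u0.
- exact: t0.
apply: eq_integral => w _; congr (_ * _)%E.
rewrite (_ : L + T - t = T - t + L); last by ring.
rewrite (qhat_survival X_markov V_meas V_ge0 _ u0 L0).
by apply: eq_integral => w' _; rewrite /= XeE.
Qed.

Let state_market_measurable t (f : borel S -> R) : 0 <= t -> measurable_fun setT f ->
  measurable_fun setT
    ((fun w => f (X x t w)) : g_sigma_algebraType (market_generators t) -> R).
Proof.
move=> t0 mf; apply: (measurableT_comp mf) => _ B mB; rewrite setTI.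
by apply: sub_gen_smallest; exists t; rewrite t0 lexx; split => //; left; exists B.
Qed.

Let alive_market_measurable t : 0 <= t ->
  measurable_fun setT
    (\1_[set w | (t%:E < tau w)%E] : g_sigma_algebraType (market_generators t) -> R).
Proof.
move=> t0; apply: measurable_indic.
rewrite (_ : [set w | _] = ~` [set w | (tau w <= t%:E)%E]); last first.
  by apply/seteqP; split=> w /=; rewrite ltNge => /negP.
apply: measurableC; apply: sub_gen_smallest; exists t; rewrite t0 lexx; split => //.
by right.
Qed.

Lemma measurable_qhat u L : 0 <= u -> 0 <= L ->
  measurable_fun setT (fun y : borel S => qhat P X V (u + L) u y).
Proof.
move=> u0 L0.
rewrite (_ : (fun y => _) =
    fine \o (fun y : borel S => \int[P]_w (EFin \o Surv L) (Xe y u w))%E); last first.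
  apply/funext => y.
  have := congr1 fine (qhat_survival X_markov V_meas V_ge0 y u0 L0).
  by rewrite [fine _%:E]/= => ->; rewrite /comp XeE.
apply: measurableT_comp => //; apply: (measurable_one_step mXe mtr).
- exact/measurable_EFinP.
- by move=> z; rewrite lee_fin.
Qed.

Lemma qhat_ge0 s t y : 0 <= qhat P X V t s y.
Proof.
rewrite /qhat unlock; apply: fine_ge0; apply: integral_ge0 => w _.
by rewrite lee_fin; apply: fine_ge0; exact: expeR_ge0.
Qed.

Lemma qhat_le1 u L y : 0 <= u -> 0 <= L -> qhat P X V (u + L) u y <= 1.
Proof.
move=> u0 L0; rewrite -lee_fin (qhat_survival X_markov V_meas V_ge0 _ u0 L0).
apply: (@le_trans _ _ (\int[P]_w 1)%E).
  apply: ge0_le_integral => //.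
  - by move=> w _; rewrite lee_fin.
  - apply/measurable_EFinP; apply: (measurableT_comp (mSurv L)).
    exact: (measurable_section X_markov).
  - by move=> w _; rewrite lee_fin.
by rewrite integral_cst// mul1e; exact: probability_le1.
Qed.

(** A longer horizon only adds killing. In the credit spread this shows that a vanishing state price
    density makes the numerator of the defaultable price vanish too. *)
Lemma q_nonincreasing L M y : 0 <= L -> L <= M -> q P X V M y <= q P X V L y.
Proof.
move=> L0 LM; have M0 := le_trans L0 LM.
rewrite (qE X_markov V_meas V_ge0 _ M0) (qE X_markov V_meas V_ge0 _ L0) -lee_fin.
rewrite -!(survivalE P mXe _ V_meas V_ge0).
apply: ge0_le_integral => //.
- by move=> w _; rewrite lee_fin killing_ge0.
- by apply/measurable_EFinP; exact: (measurable_killing mXe).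
- by apply/measurable_EFinP; exact: (measurable_killing mXe).
- by move=> w _; rewrite lee_fin; exact: (killing_nonincreasing mXe V_meas V_ge0).
Qed.

Context (lambda : R -> R).
Hypothesis lambda_ge0 : forall t, 0 <= t -> 0 <= lambda t.

Let pi t w := q P X V (lambda t) (X x t w).

Let is_priceP t T (H Y p : Om -> R) :
  (forall Z, cond_exp P (market_filtration (X x) tau t) (fun w => H w * pi T w) Z <->
     {ae P, forall w, Z w = Y w}) ->
  is_price P (market_filtration (X x) tau) pi t T H p <->
  {ae P, forall w, p w = (pi t w)^-1 * Y w}.
Proof.
move=> HY; split=> [[Z /HY ZY pZ]|pY].
  by apply: filterS2 ZY pZ => w -> ->.
by exists Y => //; apply/HY; exact: aeW.
Qed.

Lemma defaultable_priceP t T (p : Om -> R) : 0 <= t -> t < T ->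
  is_price P (market_filtration (X x) tau) pi t T (defaultable_payoff tau T) p <->
  {ae P, forall w, p w = \1_[set w' | (t%:E < tau w')%E] w *
     (q P X V (lambda T + T - t) (X x t w) / pi t w)}.
Proof.
move=> t0 tT; have T0 := le_trans t0 (ltW tT).
have L0 : 0 <= lambda T + T - t by rewrite -addrA addr_ge0 ?lambda_ge0// subr_ge0 ltW.
pose Y w := \1_[set w' | (t%:E < tau w')%E] w * Surv (lambda T + T - t) (X x t w).
have le1 r L w : \1_[set w' | (r%:E < tau w')%E] w * Surv L (X x r w) <= 1.
  by rewrite alive_indic; case: ltP => _; rewrite ?mul1r ?mul0r.
have mXt r : 0 <= r -> measurable_fun [set: Om] (X x r).
  exact: (measurable_section X_markov).
rewrite (is_priceP (Y := Y)).
  have YE w : (pi t w)^-1 * Y w = \1_[set w' | (t%:E < tau w')%E] w *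
      (q P X V (lambda T + T - t) (X x t w) / pi t w).
    by rewrite /Y (qE X_markov V_meas V_ge0 _ L0) mulrCA (mulrC (pi t w)^-1).
  by split; apply: filterS => w ->; rewrite YE.
have payE : (fun w => defaultable_payoff tau T w * pi T w) =
    (fun w => \1_[set w' | (T%:E < tau w')%E] w * Surv (lambda T) (X x T w)).
  by apply/funext => w; rewrite /pi (qE X_markov V_meas V_ge0 _ (lambda_ge0 T0)).
have iY r L : 0 <= r -> P.-integrable setT
    (EFin \o (fun w => \1_[set w' | (r%:E < tau w')%E] w * Surv L (X x r w))).
  move=> r0; apply: integrable01.
  + apply: measurable_funM; first exact: alive_measurable.
    exact: (measurableT_comp (mSurv L) (mXt r r0)).
  + by move=> w; apply: mulr_ge0; [exact: alive_ge0|exact: Surv_ge0].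
  + by move=> w; exact: le1.
move=> Z; rewrite payE; apply: cond_expP.
- exact: market_measurable.
- exact: iY.
- exact: iY.
- move=> B mB; rewrite -[X in <<s _ >> X]setTI.
  have : measurable_fun setT (Y : g_sigma_algebraType (market_generators t) -> R).
    apply: measurable_funM; first exact: alive_market_measurable.
    exact: state_market_measurable.
  by apply.
- by move=> A GA; apply: defaultable_payoff_integral => //; [exact: lambda_ge0|exact: ltW].
Qed.

Lemma default_free_priceP t T (p : Om -> R) : 0 <= t -> t < T ->
  is_price P (market_filtration (X x) tau) pi t T (@default_free_payoff R Om) p <->
  {ae P, forall w, p w = qhat P X V (lambda T + T - t) (T - t) (X x t w) / pi t w}.
Proof.
move=> t0 tT; have T0 := le_trans t0 (ltW tT).
have u0 : 0 <= T - t by rewrite subr_ge0 ltW.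
have lamE : lambda T + T - t = T - t + lambda T by ring.
pose Y w := qhat P X V (lambda T + T - t) (T - t) (X x t w).
have mq : measurable_fun setT
    (fun y : borel S => qhat P X V (lambda T + T - t) (T - t) y).
  by rewrite lamE; apply: measurable_qhat => //; exact: lambda_ge0.
have mXt r : 0 <= r -> measurable_fun [set: Om] (X x r).
  exact: (measurable_section X_markov).
have payE : (fun w => default_free_payoff R w * pi T w) =
    (fun w => Surv (lambda T) (X x T w)).
  by apply/funext => w; rewrite /default_free_payoff mul1r /pi
    (qE X_markov V_meas V_ge0) ?lambda_ge0.
rewrite (is_priceP (Y := Y)).
  by split; apply: filterS => w ->; rewrite mulrC.
move=> Z; rewrite payE; apply: cond_expP.
- exact: market_measurable.
- apply: integrable01.
  + exact: (measurableT_comp (mSurv _) (mXt T T0)).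
  + by move=> w; exact: Surv_ge0.
  + by move=> w; exact: Surv_le1.
- apply: integrable01.
  + exact: (measurableT_comp mq (mXt t t0)).
  + by move=> w; exact: qhat_ge0.
  + by move=> w; rewrite /Y lamE; apply: qhat_le1 => //; exact: lambda_ge0.
- move=> B mB; rewrite -[X in <<s _ >> X]setTI.
  exact: (state_market_measurable t0 mq).
- by move=> A GA; apply: default_free_payoff_integral => //; [exact: lambda_ge0|exact: ltW].
Qed.

End market.

Theorem theorem3p1 (R : realType) (d : measure_display)
    (Om : measurableType d) (P : probability Om R)
    (S : ptopologicalType) (S_polish : polish_space R S)
    (X : S -> R -> Om -> borel S) (X_markov : markov_process P X)
    (V : borel S -> R) (V_meas : measurable_fun [set: borel S] V)
    (V_ge0 : forall y, 0 <= V y)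
    (lambda : R -> R) (lambda_ge0 : forall t, 0 <= t -> 0 <= lambda t)
    (lambda_nd : forall s t, 0 <= s -> s <= t -> lambda s <= lambda t)
    (x : S) (tau : Om -> \bar R) (tau_meas : measurable_fun [set: Om] tau)
    (X_market_markov : markov_wrt P X x (market_filtration (X x) tau))
    (tau_law : forall t, 0 <= t ->
       cond_exp P (natural_filtration (X x) t)
         (\1_[set w | (t%:E < tau w)%E]) (discount V (X x) 0 t))
    (FX0_trivial : natural_filtration (X x) 0 = [set [set: Om]; set0])
    (G0_trivial : market_filtration (X x) tau 0 = [set [set: Om]; set0]) :
  let G := market_filtration (X x) tau in
  let pi := fun t w => q P X V (lambda t) (X x t w) in
  let log_ratio := fun t w (U : R) =>
    ln (qhat P X V (lambda U + U - t) (U - t) (X x t w) /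
        qhat P X V (lambda U + U - t) 0 (X x t w)) in
  forall t T : R, 0 <= t -> t < T ->
  [/\ forall Pd : Om -> R,
        is_price P G pi t T (defaultable_payoff tau T) Pd <->
        {ae P, forall w, Pd w = \1_[set w' | (t%:E < tau w')%E] w *
           (q P X V (lambda T + T - t) (X x t w) / q P X V (lambda t) (X x t w))},
      forall Pf : Om -> R,
        is_price P G pi t T (@default_free_payoff R Om) Pf <->
        {ae P, forall w, Pf w =
           qhat P X V (lambda T + T - t) (T - t) (X x t w) /
           q P X V (lambda t) (X x t w)}
    & {ae P, forall w, (t%:E < tau w)%E -> derivable (log_ratio t w) T 1} ->
      forall c : Om -> R,
        is_credit_spread P G pi tau t T c <->
        {ae P, forall w, (t%:E < tau w)%E -> c w = derive1 (log_ratio t w) T}].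
Proof.
move=> G pi log_ratio t T t0 tT.
have priceD U p tU := defaultable_priceP X_markov V_meas V_ge0 tau_meas
  X_market_markov tau_law lambda_ge0 (T := U) p t0 tU.
have priceF U p tU := default_free_priceP X_markov V_meas V_ge0 tau_meas
  X_market_markov lambda_ge0 (T := U) p t0 tU.
split; [by move=> p; exact: priceD|by move=> p; exact: priceF|].
move=> d_ratio c.
(* These price curves are given by the formulas at every maturity [U] and every [w]. *)
pose PD U w := \1_[set w' | (t%:E < tau w')%E] w *
  (q P X V (lambda U + U - t) (X x t w) / pi t w).
pose PF U w := qhat P X V (lambda U + U - t) (U - t) (X x t w) / pi t w.
have ratioE U w : t < U -> (t%:E < tau w)%E ->
    ln (PD U w / PF U w) = - log_ratio t w U.
  move=> tU tw; rewrite /PD /PF /log_ratio /pi indicE mem_set// mul1r.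
  set den := q P X V (lambda U + U - t) (X x t w).
  set num := qhat P X V (lambda U + U - t) (U - t) (X x t w).
  have num0 : 0 <= num by exact: qhat_ge0.
  have den0 : 0 <= den by exact: qhat_ge0.
  rewrite -[qhat _ _ _ _ 0 _]/den -ln_inv ?divr_ge0// [in RHS]invf_div.
  (* A nonzero density cancels from the ratio. If it is 0, both prices are 0 by convention, and
     [den] is 0 as well, because its horizon is at least [lambda t]; both logarithms are then taken
     at 0. *)
  have [pi0|pi0] := eqVneq (q P X V (lambda t) (X x t w)) 0; last first.
    by congr ln; rewrite invf_div mulrA divfK.
  suff -> : den = 0 by rewrite !mul0r.
  apply/eqP; rewrite eq_le den0 andbT -pi0.
  apply: (q_nonincreasing X_markov V_meas V_ge0); first exact: lambda_ge0.
  by rewrite -addrA ler_wpDr ?subr_ge0 ?(ltW tU)// lambda_nd// ltW.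
split=> [[Pd [Pf [Pd_price Pf_price cE]]]|cE].
(* Arbitrary price curves agree with the formulas only almost surely at each maturity. The
   maturities [T] and [T + 1/(n+1)] are countably many, so one null set serves them all. *)
- have U0 n : t < n.+1%:R^-1 + T by rewrite ltr_wpDl.
  have ae_price U : t < U -> {ae P, forall w, (t%:E < tau w)%E ->
      ln (Pd U w / Pf U w) = - log_ratio t w U}.
    move=> tU; have := (priceD U _ tU).1 (Pd_price _ tU).
    have := (priceF U _ tU).1 (Pf_price _ tU).
    by apply: filterS2 => w -> -> tw; rewrite -ratioE.
  have ae_prices := ae_foralln (fun n => ae_price _ (U0 n)).
  apply: filterS2 (filterI (ae_price T tT) ae_prices) (filterI d_ratio cE)
    => w [priceT prices] [dr cw] tw.
  have [df ->] := cw tw.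
  have cvg_ratio := derive1_cvg_invn (dr tw).
  have cvg_price := derive1_cvg_invn df.
  (* Along these maturities the difference quotients of the two curves are opposite, hence so are
     their limits. *)
  apply: (@cvg_unique _ (@norm_hausdorff _ R^o) _ _ _ _ _ cvg_ratio).
  rewrite (_ : (fun n => _) = (fun n => - (n.+1%:R *
      (ln (Pd (n.+1%:R^-1 + T) w / Pf (n.+1%:R^-1 + T) w) - ln (Pd T w / Pf T w))))).
    exact: cvgN.
  by apply/funext => n; rewrite (prices n tw) (priceT tw); ring.
- exists PD, PF; split.
  + by move=> U tU; apply/priceD => //; exact: aeW.
  + by move=> U tU; apply/priceF => //; exact: aeW.
  + move: d_ratio cE; apply: filterS2 => w dr cw tw.
    (* The identity [ratioE] needs [t < U], which holds near [T] and so suffices for the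
       derivative. *)
    have near_ratio : {near T, - log_ratio t w =1 (fun U => ln (PD U w / PF U w))}.
      near=> U; rewrite ratioE//; near: U; exact: lt_nbhsr.
    split.
      by apply: (near_eq_derivable near_ratio); apply: derivableN; exact: dr.
    rewrite cw// !derive1E -(near_eq_derive _ near_ratio) deriveN ?opprK//.
    exact: dr.
Unshelve. all: by end_near. Qed.
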